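(* Any quantum distributed algorithm (in the quantum routing model) solving Implicit Leader Election with bounded error on graphs of diameter at least $3$ must send $\Omega(n)$ quantum messages, in the worst case over $n$-node networks of diameter at least $3$ and their port numberings.
   Context: Quantum routing model. The network is an undirected connected graph $G=(V,E)$, $n=|V|$, $m=|E|$. Each node $u$ has $\deg(u)$ numbered ports, each connected to one neighbour; nodes have no identities and initially have only local knowledge (they do not know who is behind a port). For each port $p=(u,v)$, node $u$ holds an emission register $u\to v$ and a reception register $u\gets v$, each holding either an $O(\log n)$-qubit message or the empty symbol $\bot$. All nodes start simultaneously, run the same algorithm, have private randomness, and know a polynomial upper bound on $n$. Computation proceeds in synchronous rounds. In each round: (1) every node applies the same local unitary to its local data, local memory and emission/reception registers; (2) the operator $\mathsf{Send}$ is applied, which for every ordered pair $(u,v)$ of neighbours swaps the contents of $u\to v$ (held by $u$) and $v\gets u$ (held by $v$). Outputs are obtained by measuring local registers. In particular a node may prepare a single message in a superposition over its ports. Message complexity. A round has message complexity $M$ if the global state of the network is a superposition of (deterministic) configurations in each of which at most $M$ non-empty messages are sent. The message complexity of an algorithm is the sum of the message complexities of its rounds. Implicit Leader Election. Every node $u$ has a variable $\mathtt{status}_u\in\{\bot,\text{NON-ELECTED},\text{ELECTED}\}$, initially $\bot$. An algorithm solves the problem in $T$ rounds if, from round $T$ onward, exactly one node has status ELECTED while all other nodes have status NON-ELECTED (non-leaders need not know the leader's identity). ''Bounded error'' means error probability smaller than some constant, usually $1/3$. *)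

(* Defs.v *)
From HB Require Import structures.
From mathcomp Require Import all_boot all_order all_algebra.
From mathcomp Require Import reals complex.

Set Implicit Arguments.
Unset Strict Implicit.
Unset Printing Implicit Defensive.

Import Order.TTheory GRing.Theory Num.Theory.

Local Open Scope ring_scope.

(* A simple graph on 'I_n with a port numbering.  [port u] is an injection of
   'I_(deg u) into the neighbours of u, hence a bijection onto them.  The names
   'I_n are never visible to the nodes. *)
Record network (n : nat) := Network {
  adj : rel 'I_n;
  adj_sym : symmetric adj;
  adj_irr : irreflexive adj;
  deg : 'I_n -> nat := fun u => #|[pred v | adj u v]|;
  port : forall u : 'I_n, 'I_(deg u) -> 'I_n;
  port_inj : forall u, injective (port (u := u));
  port_adj : forall u (i : 'I_(deg u)), adj u (port i)
}.

Definition connected n (G : network n) : Prop :=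
  forall u v, connect (adj G) u v.

Definition walk n (G : network n) (u v : 'I_n) (k : nat) : bool :=
  [exists p : k.-tuple 'I_n, path (adj G) u p && (last u p == v)].

(* In a connected graph every distance is smaller than n; the value is n when
   v is not reachable from u. *)
Definition dist n (G : network n) (u v : 'I_n) : nat :=
  find (walk G u v) (iota 0 n).

Definition diameter n (G : network n) : nat :=
  (\max_(u < n) \max_(v < n) dist G u v)%N.

Definition port_to n (G : network n) (u v : 'I_n) : option 'I_(deg G u) :=
  [pick i : 'I_(deg G u) | port i == v].

Inductive status := Undecided | NonElected | Elected.

Definition status_code (s : status) : option bool :=
  match s with
  | Undecided => None
  | NonElected => Some false
  | Elected => Some true
  end.

Definition status_decode (b : option bool) : status :=
  match b with
  | None => Undecided
  | Some false => NonElected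
  | Some true => Elected
  end.

Lemma status_codeK : cancel status_code status_decode.
Proof. by case. Qed.

HB.instance Definition _ := Finite.copy status (can_type status_codeK).

(* Basis states of a register holding a q-qubit message or the empty symbol. *)
Definition register (q : nat) : finType := option (q.-tuple bool).

(* Basis states of a node with d ports and memory basis M: its status, its
   memory, its emission registers and its reception registers. *)
Definition local_basis (q : nat) (M : finType) (d : nat) : finType :=
  (status * M * {ffun 'I_d -> register q} * {ffun 'I_d -> register q})%type.

Section LocalBasis.
Context {q : nat} {M : finType} {d : nat}.
Implicit Type s : local_basis q M d.

Definition status_of s : status := s.1.1.1.
Definition memory_of s : M := s.1.1.2.
Definition emission s : {ffun 'I_d -> register q} := s.1.2.
Definition reception s : {ffun 'I_d -> register q} := s.2.

End LocalBasis.

Definition sqmod (R : realType) (z : R[i]) : R :=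
  complex.Re z ^+ 2 + complex.Im z ^+ 2.

(* What the nodes run once the upper bound on n is fixed.  Nodes are anonymous:
   the code depends only on the degree and on the round number (the nodes start
   simultaneously, so they share a clock).  The initial memory is an arbitrary
   pure state, the same for all nodes of the same degree; a private random
   string is a register holding \sum_r sqrt(p_r) |r>|r>.  The entry of [unitary]
   at (x, y) is the amplitude <x|U|y>. *)
Record protocol (R : realType) := Protocol {
  qubits : nat;
  memory : nat -> finType;
  init_memory : forall d, memory d -> R[i];
  init_memory_unit : forall d, \sum_(x : memory d) sqmod (init_memory x) = 1;
  unitary : forall t d : nat, 'M[R[i]]_#|local_basis qubits (memory d) d|;
  unitary_unitary : forall t d, unitary t d \is unitarymx
}.

Section Execution.
Context {R : realType} {n : nat}.
Variables (P : protocol R) (G : network n).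

Definition node_basis (u : 'I_n) : finType :=
  local_basis (qubits P) (memory P (deg G u)) (deg G u).

Definition config : finType := {dffun forall u : 'I_n, node_basis u}.

Definition state := {ffun config -> R[i]}.

Definition empty_registers d : {ffun 'I_d -> register (qubits P)} :=
  [ffun=> None].

Definition init_amplitude (u : 'I_n) (s : node_basis u) : R[i] :=
  if [&& status_of s == Undecided, emission s == empty_registers (deg G u)
       & reception s == empty_registers (deg G u)]
  then init_memory (memory_of s) else 0.

Definition init_state : state :=
  [ffun c : config => \prod_(u < n) init_amplitude (c u)].

(* The tensor product of the local unitaries of round t. *)
Definition local_step (t : nat) (psi : state) : state :=
  [ffun c : config => \sum_(c' : config)
     (\prod_(u < n)
        unitary P t (deg G u) (enum_rank (c u)) (enum_rank (c' u))) * psi c'].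

(* The contents of the registers v -> u and v <- u held by v. *)
Definition emitted (c : config) (v u : 'I_n) : register (qubits P) :=
  obind (fun j => emission (c v) j) (port_to G v u).

Definition received (c : config) (v u : 'I_n) : register (qubits P) :=
  obind (fun j => reception (c v) j) (port_to G v u).

Definition send_config (c : config) : config :=
  [ffun u => ((status_of (c u), memory_of (c u),
               [ffun i => received c (port i) u]),
               [ffun i => emitted c (port i) u]) : node_basis u].

Definition send (psi : state) : state :=
  [ffun c => \sum_(c' | send_config c' == c) psi c'].

Fixpoint run (t : nat) : state :=
  if t is t'.+1 then send (local_step t' (run t')) else init_state.

(* Send is a swap, so it carries across an edge the content of a reception
   register as well as that of an emission register.  Both are counted, for
   otherwise a node could communicate for free by writing in its reception
   registers.  When the reception registers are empty before Send, as they are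
   for an algorithm that moves the messages it received to its memory, this is
   the number of non-empty emission registers. *)
Definition config_messages (c : config) : nat :=
  (\sum_(u < n) (#|[set i | emission (c u) i != None]|
                 + #|[set i | reception (c u) i != None]|))%N.

(* Round t is the round that leads from [run t] to [run t.+1]. *)
Definition round_messages (t : nat) : nat :=
  (\max_(c | local_step t (run t) c != 0%R) config_messages c)%N.

Definition message_complexity (T : nat) : nat :=
  (\sum_(t < T) round_messages t)%N.

Definition leader_elected (c : config) : bool :=
  [exists u, (status_of (c u) == Elected)
     && [forall v, (v != u) ==> (status_of (c v) == NonElected)]].

(* The probability that measuring all status registers after t rounds gives a
   valid outcome. *)
Definition success_probability (t : nat) : R :=
  \sum_(c | leader_elected c) sqmod (run t c).

Definition solves_leader_election (T : nat) : Prop :=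
  forall t, (T <= t)%N -> 1 - success_probability t <= 3%:R^-1.

End Execution.

(* A family of protocols indexed by the upper bound on the size that is given to
   the nodes; on n-node networks this bound is [bound n], and [time n] is the
   number of rounds. *)
Record algorithm (R : realType) := Algorithm {
  code : nat -> protocol R;
  bound : nat -> nat;
  time : nat -> nat;
  bound_ge : forall n, (n <= bound n)%N;
  bound_poly : exists a k : nat, forall n, (bound n <= a * n ^ k + a)%N;
  qubits_log : exists a : nat, forall n,
    (1 < n)%N -> (qubits (code (bound n)) <= a * up_log 2 n)%N
}.

Definition protocol_at (R : realType) (A : algorithm R) (n : nat) : protocol R :=
  code A (bound A n).

(* Main.v *)
Require Import Defs.
From mathcomp Require Import all_boot all_order all_algebra.
From mathcomp Require Import reals complex.
From mathcomp Require Import ring lra zify.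

Set Implicit Arguments.
Unset Strict Implicit.
Unset Printing Implicit Defensive.

Import Order.TTheory GRing.Theory Num.Theory.

Local Open Scope ring_scope.

(* Take five disjoint regular circulant rings, two of one size and three of
   another.  Started on this disconnected network, the state stays a product over
   the rings, equal on rings of the same size, and then exactly one leader is
   elected with probability at most 1/2.  For each of the N ~ n^2 chords e, cutting
   the chord e of every ring and reconnecting the ends cyclically gives a connected
   network G_e of diameter at least 3 that is locally indistinguishable.

   The disconnected network is outside the promise, so nothing bounds its messages,
   and the rounds in which G_e sends messages may depend on e: the usual hybrid
   argument does not apply.  Instead, the average chi of the states psi_e on the
   networks G_e is followed.  If A_t is the average over e of the messages of round
   t, then chi departs from an evolution on the disconnected network by a vector w
   with |w|^2 <= 4 A_t / N, since a configuration with m messages sees at most m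
   chords; and w only meets the part s of chi that sends messages, of norm
   |s|^2 <= A_t.  By AM-GM, |chi|^2 drops by O(A_t / sqrt N).  A subnormalised
   product state phi follows chi: in each round, either the part y of phi - chi
   that sends messages is large compared with s and w, and projecting phi onto the
   configurations without messages brings it closer to chi, or it is small, and
   evolving phi costs only O(|y| |w| + |w|^2) = O(A_t / sqrt N).  If the total
   number of messages is small with respect to sqrt N for every e, then chi is
   close both to a unit vector and to a product state, and its success probability
   is too small. *)

(** * Squared moduli *)

Section SquaredModulus.
Variable R : realType.
Implicit Types (x y z : R[i]) (I : finType).

Lemma sqmod_ge0 z : 0 <= sqmod z.
Proof. by rewrite /sqmod addr_ge0 ?sqr_ge0. Qed.

Lemma sqmod0 : sqmod (0 : R[i]) = 0.
Proof. by rewrite /sqmod /= expr0n addr0. Qed.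

Lemma sqmod_eq0 z : (sqmod z == 0) = (z == 0).
Proof.
case: z => a b; rewrite /sqmod /= paddr_eq0 ?sqr_ge0 // !sqrf_eq0.
by rewrite eq_complex.
Qed.

Lemma sqmodN z : sqmod (- z) = sqmod z.
Proof. by case: z => a b; rewrite /sqmod /= !sqrrN. Qed.

Lemma sqmodM x y : sqmod (x * y) = sqmod x * sqmod y.
Proof. by case: x => a b; case: y => c d; rewrite /sqmod /=; ring. Qed.

Lemma sqmod_prod I (F : I -> R[i]) :
  sqmod (\prod_i F i) = \prod_i sqmod (F i).
Proof.
apply: (big_morph (@sqmod R) sqmodM).
by rewrite /sqmod /= expr1n expr0n addr0.
Qed.

Lemma sqmod_inv_nat n : sqmod (n%:R^-1 : R[i]) = n%:R^-1 ^+ 2.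
Proof.
case: n => [|n]; first by rewrite !invr0 sqmod0 expr0n.
have E : sqmod (n.+1%:R : R[i]) = n.+1%:R ^+ 2.
  have -> : (n.+1%:R : R[i]) = (n.+1%:R : R)%:C%C by rewrite rmorph_nat.
  by rewrite /sqmod /= expr0n addr0.
have n0 : (n.+1%:R : R) != 0 by rewrite pnatr_eq0.
apply: (@mulfI _ (n.+1%:R ^+ 2)); first by rewrite expf_neq0.
rewrite -{1}E -sqmodM mulfV ?pnatr_eq0 // -exprMn mulfV //.
by rewrite /sqmod /= !expr1n expr0n addr0.
Qed.

Lemma sqmodE z : (sqmod z)%:C%C = z * Num.conj z.
Proof.
case: z => a b; rewrite /sqmod /=; apply/eqP; rewrite eq_complex /=.
by apply/andP; split; apply/eqP; ring.
Qed.

Lemma sqmodD_le2 x y : sqmod (x + y) <= 2 * sqmod x + 2 * sqmod y.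
Proof.
case: x => a b; case: y => c d; rewrite /sqmod /=.
by have := sqr_ge0 (a - c); have := sqr_ge0 (b - d); nra.
Qed.

(** The cross term is at most [k^-1 * |x|^2 + k * |y|^2] by AM-GM; a large [k] leaves [x] almost
    unchanged and puts the cost on [y]. *)
Lemma sqmodD_le (k : R) x y : 0 < k ->
  sqmod (x + y) <= (1 + k^-1) * sqmod x + (1 + k) * sqmod y.
Proof.
move=> k0; set l := k^-1; have kl : k * l = 1 by rewrite mulfV ?gt_eqF.
have l0 : 0 < l by rewrite invr_gt0.
have AM (s t : R) : 2 * (s * t) <= l * s ^+ 2 + k * t ^+ 2.
  have -> : l * s ^+ 2 + k * t ^+ 2 = l * (s - k * t) ^+ 2 + 2 * (k * l) * s * t
     + k * (1 - k * l) * t ^+ 2 by ring.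
  rewrite kl subrr mulr0 mul0r addr0 mulr1 -mulrA ler_wpDl // mulr_ge0 ?sqr_ge0 //.
  exact: ltW.
case: x => a b; case: y => c d; rewrite /sqmod /=.
by have := AM a c; have := AM b d; nra.
Qed.

Lemma sqmodD_ge (k : R) x y : 0 < k ->
  (1 - k^-1) * sqmod x - k * sqmod y <= sqmod (x + y).
Proof.
move=> k0; set l := k^-1; have kl : k * l = 1 by rewrite mulfV ?gt_eqF.
have l0 : 0 < l by rewrite invr_gt0.
have AM (s t : R) : - (2 * (s * t)) <= l * s ^+ 2 + k * t ^+ 2.
  have -> : l * s ^+ 2 + k * t ^+ 2 = l * (s + k * t) ^+ 2 - 2 * (k * l) * s * t
     + k * (1 - k * l) * t ^+ 2 by ring.
  rewrite kl subrr mulr0 mul0r addr0 mulr1 -mulrA ler_wpDl // mulr_ge0 ?sqr_ge0 //.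
  exact: ltW.
case: x => a b; case: y => c d; rewrite /sqmod /=.
by have := AM a c; have := AM b d; nra.
Qed.

(** Cauchy-Schwarz in variance form: with [n = #|A|] and [S] the sum, [n] times the gap is the sum
    of the squares [(n * F i - S) ^+ 2]. *)
Lemma sqr_sum_le I (A : {set I}) (F : I -> R) :
  (\sum_(i in A) F i) ^+ 2 <= #|A|%:R * \sum_(i in A) F i ^+ 2.
Proof.
have [A0|A0] := eqVneq #|A| 0%N.
  by rewrite A0 mul0r (eq_bigl _ _ (card0_eq A0)) big_pred0_eq expr0n.
set S := \sum_(i in A) F i; set n : R := #|A|%:R.
have n0 : 0 < n by rewrite ltr0n lt0n.
rewrite -(ler_pM2l n0) -subr_ge0.
have -> : n * (n * \sum_(i in A) F i ^+ 2) - n * S ^+ 2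
    = \sum_(i in A) (n * F i - S) ^+ 2.
  transitivity (\sum_(i in A) (n ^+ 2 * F i ^+ 2 + (-2 * n * S) * F i + S ^+ 2)).
    by rewrite !big_split /= sumr_const -!mulr_sumr -/S -mulr_natr -/n; ring.
  by apply: eq_bigr => i _; ring.
by apply: sumr_ge0 => i _; exact: sqr_ge0.
Qed.

Lemma sqmod_sum_le I (A : {set I}) (F : I -> R[i]) :
  sqmod (\sum_(i in A) F i) <= #|A|%:R * \sum_(i in A) sqmod (F i).
Proof.
rewrite /sqmod big_split mulrDr /= !raddf_sum.
by apply: lerD; exact: sqr_sum_le.
Qed.

End SquaredModulus.

(** * Tensor product steps *)

Section TensorStep.
Variables (R : realType) (V B : finType).
Local Notation cfg := {ffun V -> B}.
Implicit Types (f g : cfg -> R[i]) (c d : cfg) (A : pred V).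

Definition mass (T : finType) (f : T -> R[i]) : R := \sum_c sqmod (f c).

Definition tensor_step (k : B -> B -> R[i]) f : cfg -> R[i] :=
  fun c => \sum_(d : cfg) (\prod_v k (c v) (d v)) * f d.

Definition mix A c d : cfg := [ffun v => if A v then c v else d v].

Definition relabel (p : V -> V) c : cfg := [ffun v => c (p v)].

Lemma mixE A c d v : mix A c d v = if A v then c v else d v.
Proof. by rewrite ffunE. Qed.

Lemma relabelE p c v : relabel p c v = c (p v).
Proof. by rewrite ffunE. Qed.

(* [f] is a product of a function of the nodes in [A] and a function of the
   others, expressed without naming the factors. *)
Definition splits A f : Prop :=
  forall c d, f (mix A c d) * f (mix A d c) = f c * f d.

(** Once the square is expanded, the sum over [c] factors node by node into inner products of
    columns of [k], which are orthonormal. *)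
Lemma mass_tensor_step k f :
  (forall y z, \sum_x k x y * Num.conj (k x z) = (y == z)%:R) ->
  mass (tensor_step k f) = mass f.
Proof.
move=> kU; apply: (@complexI R); rewrite /mass !raddf_sum /=.
under eq_bigr => c _.
  rewrite sqmodE /tensor_step rmorph_sum big_distrlr /=.
  over.
rewrite exchange_big /=; apply: eq_bigr => d _.
rewrite exchange_big /=.
have orth (d' : cfg) : \sum_(c : cfg) \prod_v (k (c v) (d v) * Num.conj (k (c v) (d' v)))
     = (d == d')%:R.
  rewrite -(bigA_distr_bigA (fun v x => k x (d v) * Num.conj (k x (d' v)))) /=.
  under eq_bigr => v _ do rewrite kU.
  have [->|dd'] := eqVneq d d'; first by rewrite big1 // => v _; rewrite eqxx.
  have [v dv] : exists v, d v != d' v.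
    apply/existsP; apply: contra_neqT dd'; rewrite negb_exists => /forallP H.
    by apply/ffunP => v; move/negPn: (H v) => /eqP.
  by rewrite (bigD1 v) //= (negPf dv) mul0r.
rewrite (bigD1 d) //= [X in _ + X]big1 ?addr0; last first.
  move=> d' dd'.
  transitivity ((\sum_(c : cfg) \prod_v (k (c v) (d v) * Num.conj (k (c v) (d' v))))
     * (f d * Num.conj (f d'))); last by rewrite orth eq_sym (negPf dd') mul0r.
  rewrite mulr_suml; apply: eq_bigr => c _.
  by rewrite big_split /= rmorphM rmorph_prod /=; ring.
transitivity ((\sum_(c : cfg) \prod_v (k (c v) (d v) * Num.conj (k (c v) (d v))))
     * (f d * Num.conj (f d))); last by rewrite orth eqxx mul1r sqmodE.
rewrite mulr_suml; apply: eq_bigr => c _.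
by rewrite big_split /= rmorphM rmorph_prod /=; ring.
Qed.

Lemma mixK A c d : mix A (mix A c d) (mix A d c) = c.
Proof. by apply/ffunP => v; rewrite !ffunE; case: (A v). Qed.

(** The pairs [(d, d')] are reindexed by the involution that trades their restrictions outside [A];
    the product of all the kernel entries only gets permuted. *)
Lemma tensor_step_splits k A f : splits A f -> splits A (tensor_step k f).
Proof.
move=> fA c c'; rewrite /tensor_step !big_distrlr /=.
rewrite !pair_big /=.
pose h (p : cfg * cfg) := (mix A p.1 p.2, mix A p.2 p.1).
have hK : cancel h h by case=> d d'; rewrite /h /= !mixK.
rewrite (reindex h) /=; last by apply: onW_bij; exists h.
apply: eq_bigr => -[d d'] _ /=.
rewrite mulrACA fA [RHS]mulrACA; congr (_ * _).
rewrite -!big_split /=; apply: eq_bigr => v _; rewrite !ffunE.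
by case: (A v) => //; rewrite mulrC.
Qed.

Lemma relabelK p p' : cancel p p' -> cancel (relabel p') (relabel p).
Proof. by move=> pK c; apply/ffunP => v; rewrite !ffunE pK. Qed.

Lemma tensor_step_relabel k f p p' : cancel p p' -> cancel p' p ->
  (forall c, f (relabel p c) = f c) ->
  forall c, tensor_step k f (relabel p c) = tensor_step k f c.
Proof.
move=> pK p'K fp c; rewrite /tensor_step (reindex (relabel p)) /=; last first.
  by apply: onW_bij; exists (relabel p'); exact: relabelK.
apply: eq_bigr => d _; rewrite fp; congr (_ * _).
rewrite [RHS](reindex p) /=; last by apply: onW_bij; exists p'.
by apply: eq_bigr => v _; rewrite !ffunE.
Qed.

End TensorStep.

(** [unitarymx] states that the rows are orthonormal; for a square matrix the columns are too, and
    this is the form that preserves the mass. *)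
Lemma unitary_entries (R : realType) (B : finType) (U : 'M[R[i]]_#|B|) :
  U \is unitarymx ->
  forall y z, \sum_x U (enum_rank x) (enum_rank y)
      * Num.conj (U (enum_rank x) (enum_rank z)) = (y == z)%:R.
Proof.
move=> /unitarymxP/mulmx1C/matrixP UU y z.
have := UU (enum_rank z) (enum_rank y).
rewrite !mxE (inj_eq enum_rank_inj) eq_sym => <-.
rewrite [RHS](reindex enum_rank) /=; last by apply: onW_bij; exact: enum_rank_bij.
by apply: eq_bigr => x _; rewrite !mxE mulrC.
Qed.

(** * Exchange of registers along a pairing of the ports *)

Section Exchange.
Variables (q : nat) (M V : finType) (D : nat).
Local Notation node := (local_basis q M D).
Local Notation cfg := {ffun V -> node}.
Local Notation port := (V * 'I_D)%type.
Implicit Types (t : port -> port) (c d : cfg) (A : pred V).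

(** The operator Send when [t] is the involution that takes each port to the port at the other end
    of its edge. *)
Definition exchange t c : cfg :=
  [ffun v => ((status_of (c v), memory_of (c v),
               [ffun i => reception (c (t (v, i)).1) (t (v, i)).2]),
              [ffun i => emission (c (t (v, i)).1) (t (v, i)).2]) : node].

Definition messages c : nat :=
  (\sum_v (#|[set i | emission (c v) i != None]|
           + #|[set i | reception (c v) i != None]|))%N.

Definition occupied c (p : port) : bool :=
  (emission (c p.1) p.2 != None) || (reception (c p.1) p.2 != None).

Lemma node_ext (s s' : node) : status_of s = status_of s' ->
  memory_of s = memory_of s' -> emission s =1 emission s' ->
  reception s =1 reception s' -> s = s'.
Proof.
case: s => [[[a b] e] r]; case: s' => [[[a' b'] e'] r'] /=.
by rewrite /status_of /memory_of /emission /reception /= => -> -> /ffunP -> /ffunP ->.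
Qed.

Lemma status_exchange t c v : status_of (exchange t c v) = status_of (c v).
Proof. by rewrite ffunE. Qed.

Lemma memory_exchange t c v : memory_of (exchange t c v) = memory_of (c v).
Proof. by rewrite ffunE. Qed.

Lemma emission_exchange t c v i :
  emission (exchange t c v) i = reception (c (t (v, i)).1) (t (v, i)).2.
Proof. by rewrite !ffunE. Qed.

Lemma reception_exchange t c v i :
  reception (exchange t c v) i = emission (c (t (v, i)).1) (t (v, i)).2.
Proof. by rewrite !ffunE. Qed.

Definition exchangeE :=
  (status_exchange, memory_exchange, emission_exchange, reception_exchange).

Lemma exchangeK t : involutive t -> involutive (exchange t).
Proof.
move=> tK c; apply/ffunP => v.
by apply: node_ext => [||i|i]; rewrite !exchangeE // -surjective_pairing tK.
Qed.

Lemma messagesE c : messages c =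
  (\sum_(p : port) ((emission (c p.1) p.2 != None)
                    + (reception (c p.1) p.2 != None)))%N.
Proof.
rewrite -(pair_bigA _ (fun v i => (emission (c v) i != None)
                    + (reception (c v) i != None)))%N /=.
by apply: eq_bigr => v _; rewrite big_split /= -!sum1dep_card -!big_mkcond.
Qed.

Lemma messages_exchange t c : involutive t -> messages (exchange t c) = messages c.
Proof.
move=> tK; rewrite !messagesE [RHS](reindex t) /=; last first.
  by apply: onW_bij; exists t.
by apply: eq_bigr => -[v i] _ /=; rewrite !ffunE /= addnC.
Qed.

Lemma card_occupied c : (#|[set p | occupied c p]| <= messages c)%N.
Proof.
rewrite messagesE -sum1dep_card big_mkcond; apply: leq_sum => p _.
by rewrite /occupied; do 2!case: (_ != None).
Qed.

(** Two pairings that differ only inside [X] move nothing but empty symbols there. Hence a rewired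
    edge goes unnoticed until one of its ports is occupied. *)
Lemma exchange_agree (X : pred port) t t' c :
  (forall p, ~~ X p -> t p = t' p) ->
  (forall p, X p -> X (t p)) -> (forall p, X p -> X (t' p)) ->
  (forall p, X p -> ~~ occupied c p) -> exchange t c = exchange t' c.
Proof.
move=> tt' Xt Xt' cX; apply/ffunP => v; apply: node_ext => [||i|i];
  rewrite !exchangeE //; have [Xp|/tt' -> //] := boolP (X (v, i));
  have := cX _ (Xt _ Xp); have := cX _ (Xt' _ Xp);
  rewrite /occupied !negb_or !negbK => /andP[/eqP e1 /eqP e2] /andP[/eqP e3 /eqP e4];
  by rewrite ?e1 ?e2 ?e3 ?e4.
Qed.

Lemma exchange_mix t A c d : (forall p, A (t p).1 = A p.1) ->
  exchange t (mix A c d) = mix A (exchange t c) (exchange t d).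
Proof.
move=> At; apply/ffunP => v; rewrite mixE.
by apply: node_ext => [||i|i]; rewrite exchangeE mixE ?At /=;
  case: (A v); rewrite exchangeE.
Qed.

Lemma exchange_relabel t p c :
  (forall v i, t (p v, i) = (p (t (v, i)).1, (t (v, i)).2)) ->
  exchange t (relabel p c) = relabel p (exchange t c).
Proof.
move=> tp; apply/ffunP => v.
by apply: node_ext => [||i|i]; rewrite [in RHS]relabelE !exchangeE relabelE // tp.
Qed.

Lemma messages_relabel p c : bijective p -> messages (relabel p c) = messages c.
Proof.
move=> pb; rewrite /messages [RHS](reindex p) /=; last exact: onW_bij.
by apply: eq_bigr => v _; rewrite relabelE.
Qed.

Lemma messages_eq0 c : (messages c == 0)%N =
  [forall v, (#|[set i | emission (c v) i != None]|
           + #|[set i | reception (c v) i != None]| == 0)%N].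
Proof. by rewrite sum_nat_eq0. Qed.

(** Silence is a condition on each node separately, so trading nodes between two configurations
    keeps both silent. This is why projecting on silence preserves product states. *)
Lemma messages_mix A c d :
  ((messages (mix A c d) == 0) && (messages (mix A d c) == 0)
   = (messages c == 0) && (messages d == 0))%N.
Proof.
rewrite !messages_eq0; apply/andP/andP => -[/forallP H /forallP K];
  split; apply/forallP => v; move: (H v) (K v); rewrite !mixE; by case: (A v).
Qed.

End Exchange.

(** * Leaders in product states *)

Section LeaderProbability.
Variables (R : realType) (V B I : finType) (st : B -> status).
Local Notation cfg := {ffun V -> B}.
Implicit Types (f : cfg -> R[i]) (c d : cfg) (W : {set V}).

Definition outcome W c : bool :=
  [forall v, st (c v) == if v \in W then Elected else NonElected].

Definition unique_leader c : bool :=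
  [exists u, (st (c u) == Elected)
     && [forall v, (v != u) ==> (st (c v) == NonElected)]].

Definition outcome_mass f W : R := \sum_(c | outcome W c) sqmod (f c).

Let winners c : {set V} := [set v | st (c v) == Elected].

Lemma outcomeP W c : outcome W c = (winners c == W) && outcome (winners c) c.
Proof.
apply/idP/andP => [Wc|[/eqP <-] //]; suff -> : winners c = W by rewrite eqxx.
by apply/setP => v; rewrite /winners inE; move/forallP/(_ v)/eqP: Wc => ->; case: (v \in W).
Qed.

Lemma unique_leaderE c : unique_leader c = [exists u, outcome [set u] c].
Proof.
apply: eq_existsb => u; apply/andP/forallP => [[uE /forallP uN] v|H].
  by rewrite inE; case: (eqVneq v u) => [->|vu] //; exact: (implyP (uN v)).
split; first by have := H u; rewrite inE eqxx.
by apply/forallP => v; apply/implyP => vu; have := H v; rewrite inE (negPf vu).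
Qed.

Lemma outcome_mass_ge0 f W : 0 <= outcome_mass f W.
Proof. by apply: sumr_ge0 => *; exact: sqmod_ge0. Qed.

Lemma sum_outcome_mass f : \sum_W outcome_mass f W <= mass f.
Proof.
have -> : \sum_W outcome_mass f W = \sum_(c | outcome (winners c) c) sqmod (f c).
  rewrite [RHS](partition_big winners xpredT) //=; apply: eq_bigr => W _.
  by apply: eq_bigl => c; rewrite outcomeP andbC.
rewrite /mass big_mkcond; apply: ler_sum => c _.
by case: ifP => // _; exact: sqmod_ge0.
Qed.

Lemma unique_leader_mass f :
  \sum_(c | unique_leader c) sqmod (f c) = \sum_u outcome_mass f [set u].
Proof.
rewrite /outcome_mass; under [RHS]eq_bigr => u _ do rewrite big_mkcond.
rewrite exchange_big big_mkcond; apply: eq_bigr => c _; rewrite unique_leaderE.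
case: existsP => [[u uc]|H]; last first.
  by rewrite big1 // => u _; case: ifP => // uc; case: H; exists u.
rewrite (bigD1 u) //= uc big1 ?addr0 // => v vu; case: ifP => //.
rewrite outcomeP => /andP[/eqP vc _].
move: uc; rewrite outcomeP vc => /andP[/eqP/set1_inj uv _].
by rewrite uv eqxx in vu.
Qed.

(** Two configurations with winners [W] and [W'] trade their nodes outside [A]: one then has all the
    winners and the other none, and [splits] keeps the product of the amplitudes. *)
Lemma outcome_mass_mul f (A : pred V) W W' : splits A f ->
  (forall v, v \in W -> A v) -> (forall v, v \in W' -> ~~ A v) ->
  outcome_mass f W * outcome_mass f W'
    = outcome_mass f (W :|: W') * outcome_mass f set0.
Proof.
move=> fA WA WA'; rewrite /outcome_mass !big_distrlr /= !pair_big /=.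
pose h (p : cfg * cfg) := (mix A p.1 p.2, mix A p.2 p.1).
have hK : cancel h h by case=> d d'; rewrite /h /= !mixK.
rewrite (reindex h) /=; last by apply: onW_bij; exists h.
apply: eq_big => [[c d]|[c d] _] /=; last by rewrite -!sqmodM fA.
have W0 v : A v -> (v \in W') = false by move=> Av; apply: contraTF Av => /WA'.
have W1 v : ~~ A v -> (v \in W) = false by apply: contraNF => /WA.
apply/andP/andP => -[/forallP H /forallP H']; split; apply/forallP => v;
  move: (H v) (H' v); rewrite ?mixE !inE; have [Av|Av] := boolP (A v);
  by rewrite ?(W0 _ Av) ?(W1 _ Av) ?orbF.
Qed.

Lemma outcome_mass_relabel f p p' u : cancel p p' -> cancel p' p ->
  (forall c, f (relabel p c) = f c) ->
  outcome_mass f [set p u] = outcome_mass f [set u].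
Proof.
move=> pK p'K fp; rewrite /outcome_mass [RHS](reindex (relabel p)) /=; last first.
  by apply: onW_bij; exists (relabel p'); exact: relabelK.
apply: eq_big => c; last by rewrite fp.
apply/forallP/forallP => H v.
  by have := H (p v); rewrite relabelE !inE (can_eq pK).
by have := H (p' v); rewrite relabelE !inE p'K (can2_eq p'K pK).
Qed.

Lemma sum_pair_outcome_mass f :
  \sum_(x : V * V | x.1 != x.2) outcome_mass f [set x.1; x.2]
    <= 2 * \sum_(W : {set V} | #|W| == 2) outcome_mass f W.
Proof.
rewrite (partition_big (fun x : V * V => [set x.1; x.2]) (fun W => #|W| == 2)) /=;
  last by move=> x; rewrite cards2 => ->.
rewrite mulr_sumr; apply: ler_sum => W /cards2P[a [b [_ ->]]].
under eq_bigr => x /andP[_ /eqP ->] do [].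
rewrite sumr_const -[leLHS]mulr_natl ler_wpM2r ?outcome_mass_ge0 // ler_nat.
apply: leq_trans (_ : #|[set (a, b); (b, a)]| <= 2)%N; last first.
  by rewrite cards2; case: (_ != _).
apply/subset_leq_card/subsetP => -[x y] /= /andP[xy /eqP/setP E].
rewrite !inE !xpair_eqE; move: (E x) (E y) xy; rewrite !inE !eqxx orbT /=.
by move=> /esym/orP[/eqP ->|/eqP ->] /esym/orP[/eqP ->|/eqP ->]; rewrite ?eqxx ?orbT.
Qed.

(* Each group of nodes has a twin on which the product state is the same, so
   that, in terms of the probabilities [S u] of the outcome where u alone is
   elected, of the probability [E0] of no leader and of the probability [E2] of
   two leaders, (\sum_u S u)^2 <= 2 \sum_(u, v in different groups) S u * S v
   <= 4 * E0 * E2. *)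
Lemma twin_unique_leader_mass f (comp : V -> I) p p' :
  cancel p p' -> cancel p' p -> (forall u v, comp u = comp v -> comp u != comp (p v)) ->
  (forall i, splits (fun v => comp v == i) f) ->
  (forall c, f (relabel p c) = f c) ->
  \sum_(c | unique_leader c) sqmod (f c) <= mass f / 2.
Proof.
move=> pK p'K twin fsplit fp; rewrite unique_leader_mass.
set S := fun u => outcome_mass f [set u].
set E0 := outcome_mass f set0; set E2 := \sum_(W : {set V} | #|W| == 2) outcome_mass f W.
have S0 u : 0 <= S u by exact: outcome_mass_ge0.
have Sp u : S (p u) = S u by exact: outcome_mass_relabel fp.
set T := \sum_u S u.
have T0 : 0 <= T by exact: sumr_ge0.
have le_mass : E0 + T + E2 <= mass f.
  apply: le_trans (sum_outcome_mass f).
  rewrite (bigID (fun W : {set V} => #|W| == 2)%N) /= -/E2 addrC lerD2r.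
  rewrite (bigD1 set0) /= ?cards0 // -/E0 lerD2l.
  rewrite (bigID (fun W : {set V} => #|W| == 1)%N) /=.
  rewrite ler_wpDr //; first by apply: sumr_ge0 => *; exact: outcome_mass_ge0.
  have -> : T = \sum_(W in [set [set u] | u : V]) outcome_mass f W.
    by rewrite big_imset //= => u v _ _ /set1_inj.
  rewrite le_eqVlt; apply/orP; left; apply/eqP; apply: eq_bigl => W.
  apply/imsetP/idP => [[u _ ->]|/andP[_ /cards1P[u ->]]].
    by rewrite cards1 -cards_eq0 cards1.
  by exists u.
(* The injection [(u, v) -> (u, p v)] sends pairs inside a group to pairs across groups with the
   same weight, so the former account for at most half of [T ^+ 2]. *)
have TT : T ^+ 2 <= 2 * \sum_(x : V * V | comp x.1 != comp x.2) S x.1 * S x.2.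
  rewrite expr2 big_distrlr /= pair_big /=.
  rewrite (bigID (fun x : V * V => comp x.1 != comp x.2)) /=.
  rewrite mulrDl mul1r lerD2l.
  have [q qK q'K] : bijective (fun x : V * V => (x.1, p x.2)).
    by exists (fun x => (x.1, p' x.2)) => -[u v] /=; rewrite ?pK ?p'K.
  rewrite [leRHS](reindex (fun x : V * V => (x.1, p x.2))) /=; last first.
    by apply: onW_bij; exists q.
  rewrite [leRHS]big_mkcond [leLHS]big_mkcond /=; apply: ler_sum => -[u v] _ /=.
  rewrite negbK Sp; case: eqP => [/twin -> //|_].
  by case: ifP => // _; exact: mulr_ge0.
have : T ^+ 2 <= 4 * (E0 * E2).
  apply: le_trans TT _.
  have -> : 4 * (E0 * E2) = 2 * (2 * E2 * E0) by ring.
  rewrite ler_pM2l //.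
  apply: (@le_trans _ _ (\sum_(x : V * V | x.1 != x.2) outcome_mass f [set x.1; x.2] * E0)).
    rewrite [leLHS]big_mkcond [leRHS]big_mkcond; apply: ler_sum => -[u v] _ /=.
    case: eqVneq => [_|uv]; first by case: ifP => // _; rewrite mulr_ge0 ?outcome_mass_ge0.
    case: eqVneq => [uv'|_] /=; first by rewrite uv' eqxx in uv.
    rewrite /S (outcome_mass_mul (fsplit (comp u))) // => w; rewrite inE => /eqP -> //.
    by rewrite eq_sym.
  by rewrite -mulr_suml ler_wpM2r ?outcome_mass_ge0 // sum_pair_outcome_mass.
have E00 : 0 <= E0 by exact: outcome_mass_ge0.
have E20 : 0 <= E2 by apply: sumr_ge0 => *; exact: outcome_mass_ge0.
(* AM-GM gives [4 * E0 * E2 <= (E0 + E2) ^+ 2]; then [T] is at most the rest of the mass, hence at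
   most half of it. *)
move=> T4; have : T <= E0 + E2.
  rewrite -(@ler_pXn2r _ 2) ?nnegrE ?addr_ge0 //.
  by apply: le_trans T4 _; have := sqr_ge0 (E0 - E2); nra.
by move: le_mass; lra.
Qed.

End LeaderProbability.

(** * Hidden edges *)

Section HiddenEdge.
Variables (R : realType) (q : nat) (M V : finType) (D : nat).
Local Notation node := (local_basis q M D).
Local Notation cfg := {ffun V -> node}.
Local Notation port := (V * 'I_D)%type.
Variables (k : nat -> node -> node -> R[i]) (f0 : node -> R[i]).
Hypothesis k_unitary : forall t y z,
  \sum_x k t x y * Num.conj (k t x z) = (y == z)%:R.
Hypothesis f0_unit : \sum_s sqmod (f0 s) = 1.
Implicit Types (f g : cfg -> R[i]) (c : cfg) (t : nat).

(** Send acts by precomposition, since an involution is its own inverse. The configuration space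
    does not depend on [tau], so states of different networks can be averaged and subtracted. *)
Fixpoint port_run (tau : port -> port) t : cfg -> R[i] :=
  if t is t'.+1
  then fun c => tensor_step (k t') (port_run tau t') (exchange tau c)
  else fun c => \prod_v f0 (c v).

Definition port_messages tau t : nat :=
  (\max_(c | tensor_step (k t) (port_run tau t) c != 0%R) messages c)%N.

Lemma mass_exchange tau f : involutive tau ->
  mass (fun c => f (exchange tau c)) = mass f.
Proof.
move=> tauK; rewrite /mass [RHS](reindex (exchange tau)) //=.
by apply: onW_bij; exists (exchange tau); exact: exchangeK.
Qed.

Lemma mass_port_run tau t : involutive tau -> mass (port_run tau t) = 1.
Proof.
move=> tauK; elim: t => [|t IH] /=.
  rewrite /mass; under eq_bigr => c _ do rewrite sqmod_prod.
  rewrite -(bigA_distr_bigA (fun _ s => sqmod (f0 s))) big1 //.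
by rewrite (mass_exchange _ tauK) mass_tensor_step.
Qed.

Lemma tensor_step_lin t f g (a : R[i]) c :
  tensor_step (k t) (fun c => f c + a * g c) c
    = tensor_step (k t) f c + a * tensor_step (k t) g c.
Proof.
rewrite /tensor_step mulr_sumr -big_split; apply: eq_bigr => d _ /=.
by ring.
Qed.

(** * Averaging over the rewired networks: [tau0] is the disconnected network, [tau e] the one
    rewired at [e], and [X e] the ports involved *)

Variables (E : finType) (tau0 : port -> port) (tau : E -> port -> port).
Variable X : E -> pred port.
Hypothesis tau0K : involutive tau0.
Hypothesis tauK : forall e, involutive (tau e).
Hypothesis tau_tau0 : forall e p, ~~ X e p -> tau e p = tau0 p.
Hypothesis X_tau0 : forall e p, X e p -> X e (tau0 p).
Hypothesis X_tau : forall e p, X e p -> X e (tau e p).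
Hypothesis X_disjoint : forall e e' p, X e p -> X e' p -> e = e'.
Variable K : nat.
Hypothesis K_gt0 : (0 < K)%N.
Hypothesis K_le : (K ^ 2 <= #|E|)%N.

Local Notation N := (#|E|%:R : R).
Local Notation NC := (#|E|%:R : R[i]).

Let E_gt0 : (0 < #|E|)%N.
Proof. by apply: leq_trans K_le; rewrite expn_gt0 K_gt0. Qed.

Let N_gt0 : 0 < N. Proof. by rewrite ltr0n. Qed.

Definition average (F : E -> cfg -> R[i]) : cfg -> R[i] :=
  fun c => NC^-1 * \sum_e F e c.

Lemma sqmod_average_le F c :
  sqmod (average F c) <= N^-1 * \sum_e sqmod (F e c).
Proof.
rewrite /average sqmodM sqmod_inv_nat expr2 -mulrA ler_pM2l ?invr_gt0 //.
rewrite ler_pdivrMl //; have := sqmod_sum_le [set: E] (fun e => F e c).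
by rewrite cardsT; congr (sqmod _ <= _ * _); apply: eq_bigl => e; rewrite inE.
Qed.

Lemma sum_average_le (P : pred cfg) F :
  \sum_(c | P c) sqmod (average F c) <= N^-1 * \sum_e \sum_(c | P c) sqmod (F e c).
Proof.
rewrite exchange_big mulr_sumr /=; apply: ler_sum => c _; exact: sqmod_average_le.
Qed.

Lemma tensor_step_average t F c :
  tensor_step (k t) (average F) c = average (fun e => tensor_step (k t) (F e)) c.
Proof.
rewrite /tensor_step /average exchange_big mulr_sumr; apply: eq_bigr => d _ /=.
by rewrite mulrCA mulr_sumr.
Qed.

Local Notation psi := (fun t e => port_run (tau e) t).
Local Notation chi := (fun t => average (psi t)).
Local Notation sent := (fun t e => tensor_step (k t) (port_run (tau e) t)).

Definition mean_messages t : R := N^-1 * \sum_e (port_messages (tau e) t)%:R.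

Lemma mean_messages_ge0 t : 0 <= mean_messages t.
Proof. by rewrite mulr_ge0 ?invr_ge0 ?ler0n // sumr_ge0. Qed.

Lemma messages_le t e c : sent t e c != 0 -> (messages c <= port_messages (tau e) t)%N.
Proof. by move=> c0; rewrite /port_messages; apply: (leq_bigmax_cond c). Qed.

Definition crossing t e c : R[i] :=
  sent t e (exchange (tau e) c) - sent t e (exchange tau0 c).

(** The local step and the exchange along [tau0] are linear and do not depend on [e], so they
    commute with the average; the remainder is the vector [w] of the overview. *)
Lemma chiS t c : chi t.+1 c =
  tensor_step (k t) (chi t) (exchange tau0 c) + average (crossing t) c.
Proof.
rewrite tensor_step_average /average -mulrDr -big_split; congr (_ * _).
by apply: eq_bigr => e _; rewrite /crossing [RHS]addrC subrK.
Qed.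

Lemma crossing_neq0 t e c : crossing t e c != 0 ->
  [exists p, X e p && occupied c p] /\ (messages c <= port_messages (tau e) t)%N.
Proof.
move=> c0; split.
  apply: contraNT c0; rewrite negb_exists => /forallP H; apply/eqP.
  rewrite /crossing (@exchange_agree _ _ _ _ (X e) (tau e) tau0) ?subrr //.
  - exact: tau_tau0.
  - exact: X_tau.
  - exact: X_tau0.
  - by move=> p Xp; have := H p; rewrite Xp.
have : (sent t e (exchange (tau e) c) != 0) || (sent t e (exchange tau0 c) != 0).
  rewrite -negb_and; apply: contraNN c0 => /andP[/eqP e1 /eqP e2].
  by rewrite /crossing e1 e2 subrr.
by case/orP => /messages_le; rewrite messages_exchange.
Qed.

Lemma crossing_mass t e : mass (crossing t e) <= 4.
Proof.
have m1 tau' : involutive tau' ->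
    \sum_c sqmod (sent t e (exchange tau' c)) = 1.
  move=> tK; have := mass_exchange (sent t e) tK.
  by rewrite mass_tensor_step // mass_port_run.
apply: (@le_trans _ _ (\sum_c (2 * sqmod (sent t e (exchange (tau e) c))
    + 2 * sqmod (sent t e (exchange tau0 c))))).
  apply: ler_sum => c _; rewrite -[in leRHS](sqmodN (sent t e (exchange tau0 c))).
  exact: sqmodD_le2.
by rewrite big_split /= -!mulr_sumr !m1 // mulr1; lra.
Qed.

(* A configuration with m messages is hit by at most m of the disjoint edges, and
   only those whose network allows m messages contribute to its amplitude. *)
Lemma mass_average_crossing t :
  mass (average (crossing t)) <= 4 * mean_messages t / N.
Proof.
pose hit c := [set e | [exists p, X e p && occupied c p]].
(* Since the sets [X e] are disjoint, an occupied port determines the edge that it hits. *)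
have hit_le c : (#|hit c| <= messages c)%N.
  apply: leq_trans (card_occupied c).
  pose owner p : option E := [pick e | X e p].
  rewrite -(card_imset (mem (hit c)) (@Some_inj _)).
  apply: leq_trans (leq_imset_card owner _); apply/subset_leq_card/subsetP => o.
  case/imsetP => e + ->; rewrite inE => /existsP[p /andP[Xp cp]].
  apply/imsetP; exists p; first by rewrite inE.
  rewrite /owner; case: pickP => [e' Xp'|/(_ e)]; last by rewrite Xp.
  by rewrite (X_disjoint Xp Xp').
have pointwise c : sqmod (\sum_e crossing t e c) <=
    \sum_e (port_messages (tau e) t)%:R * sqmod (crossing t e c).
  have -> : \sum_e crossing t e c = \sum_(e in hit c) crossing t e c.
    rewrite [RHS]big_mkcond; apply: eq_bigr => e _; case: ifP => // /negP eN.
    by apply/eqP; apply: contra_notT eN => /crossing_neq0[H _]; rewrite inE.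
  apply: le_trans (sqmod_sum_le _ _) _; rewrite mulr_sumr big_mkcond.
  apply: ler_sum => e _.
  have H : 0 <= (port_messages (tau e) t)%:R * sqmod (crossing t e c).
    by rewrite mulr_ge0 ?ler0n ?sqmod_ge0.
  case: ifP => // _; have [->|/crossing_neq0[_ le]] := eqVneq (crossing t e c) 0.
    by rewrite sqmod0 !mulr0.
  by rewrite ler_wpM2r ?sqmod_ge0 // ler_nat (leq_trans (hit_le c)).
rewrite /mass /average; under eq_bigr => c _ do rewrite sqmodM sqmod_inv_nat.
rewrite -mulr_sumr /mean_messages.
have -> : 4 * (N^-1 * \sum_e (port_messages (tau e) t)%:R) / N
   = N^-1 ^+ 2 * \sum_e (port_messages (tau e) t)%:R * 4.
  by rewrite -mulr_suml; ring.
rewrite ler_wpM2l ?sqr_ge0 //.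
apply: le_trans (ler_sum _ (fun c _ => pointwise c)) _.
rewrite exchange_big /=; apply: ler_sum => e _.
by rewrite -mulr_sumr ler_wpM2l ?ler0n //; exact: crossing_mass.
Qed.

(** By convexity each network can be treated alone: it contributes nothing if it sends no message in
    the round, and otherwise at most its mass 1, which is at most its number of messages. *)
Lemma loud_mass t : \sum_(c | messages c != 0%N)
    sqmod (tensor_step (k t) (chi t) (exchange tau0 c)) <= mean_messages t.
Proof.
rewrite (reindex (exchange tau0)) /=; last first.
  by apply: onW_bij; exists (exchange tau0); exact: exchangeK.
under eq_bigl => c do rewrite messages_exchange //.
under eq_bigr => c _ do rewrite exchangeK // tensor_step_average.
apply: le_trans (sum_average_le _ _) _; rewrite ler_pM2l ?invr_gt0 //.
apply: ler_sum => e _.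
have [M0|M0] := posnP (port_messages (tau e) t).
  rewrite M0 big1 // => c c0.
  have [->|/messages_le] := eqVneq (sent t e c) 0; first by rewrite sqmod0.
  by rewrite M0 leqn0 (negPf c0).
apply: (@le_trans _ _ (mass (sent t e))).
  rewrite /mass big_mkcond; apply: ler_sum => c _.
  by case: ifP => // _; exact: sqmod_ge0.
by rewrite mass_tensor_step // mass_port_run // ler1n.
Qed.

Let k_gt0 : 0 < (K%:R : R). Proof. by rewrite ltr0n. Qed.

Let K_mean t : K%:R * (4 * mean_messages t / N) <= 4 * mean_messages t / K%:R.
Proof.
have m0 : 0 <= 4 * mean_messages t by have := mean_messages_ge0 t; lra.
rewrite mulrCA (ler_wpM2l m0) // ler_pdivrMr // mulrC ler_pdivlMr //.
by rewrite -expr2 -natrX ler_nat.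
Qed.

(** [w] vanishes on silent configurations. On the others AM-GM with weight [K] loses
    [|s|^2 / K + K * |w|^2], that is, at most 1 + 4 times [mean_messages t / K], because
    [K ^ 2 <= N]. *)
Lemma mass_chiS t :
  mass (chi t) - 5 * mean_messages t / K%:R <= mass (chi t.+1).
Proof.
set Z := fun c => tensor_step (k t) (chi t) (exchange tau0 c).
set w := average (crossing t).
have mZ : mass Z = mass (chi t) by rewrite mass_exchange // mass_tensor_step.
have pw c : sqmod (Z c) - (if messages c != 0%N then K%:R^-1 * sqmod (Z c) else 0)
    - K%:R * sqmod (w c) <= sqmod (chi t.+1 c).
  rewrite chiS -/(Z c) -/(w c); case: eqP => [c0|_] /=.
    have -> : w c = 0.
      rewrite /w /average big1 ?mulr0 // => e _; apply/eqP.
      apply: contraTT isT => /crossing_neq0[/existsP[p /andP[_ cp]] _].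
      move: (card_occupied c); rewrite c0 leqn0 cards_eq0 => /eqP/setP/(_ p).
      by rewrite !inE cp.
    by rewrite addr0 sqmod0; lra.
  by have := sqmodD_ge (Z c) (w c) k_gt0; lra.
apply: le_trans (_ : \sum_c (sqmod (Z c)
    - (if messages c != 0%N then K%:R^-1 * sqmod (Z c) else 0)
    - K%:R * sqmod (w c)) <= _); last by apply: ler_sum => c _; exact: pw.
rewrite !sumrB -big_mkcond /= -!mulr_sumr -/(mass Z) mZ.
have := loud_mass t; rewrite -/Z => loud.
have := mass_average_crossing t; rewrite -/w => cross.
have l1 : K%:R^-1 * (\sum_(c | messages c != 0%N) sqmod (Z c)) <= mean_messages t / K%:R.
  by rewrite mulrC ler_wpM2r // invr_ge0 ltW.
have l2 : K%:R * mass w <= 4 * mean_messages t / K%:R.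
  by apply: le_trans (K_mean t); rewrite ler_pM2l.
rewrite /mass in l2 *.
have -> : 5 * mean_messages t / K%:R =
  mean_messages t / K%:R + 4 * mean_messages t / K%:R by ring.
lra.
Qed.

(** * Product states that follow the average; [tau0] never leaves a group of [comp], and [p] takes
    each node to its twin *)

Variables (I : finType) (comp : V -> I) (p p' : V -> V).
Hypothesis comp_tau0 : forall x, comp (tau0 x).1 = comp x.1.
Hypothesis pK : cancel p p'.
Hypothesis p'K : cancel p' p.
Hypothesis comp_p : forall u v, comp u = comp v -> comp u != comp (p v).
Hypothesis tau0_p : forall v i, tau0 (p v, i) = (p (tau0 (v, i)).1, (tau0 (v, i)).2).

(** The mass is only bounded by 1, since projecting on silence may lower it. *)
Definition disconnected f : Prop :=
  [/\ forall i, splits (fun v => comp v == i) f,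
      forall c, f (relabel p c) = f c & mass f <= 1].

Definition silence f : cfg -> R[i] := fun c => if messages c == 0%N then f c else 0.

Lemma disconnected_step t f : disconnected f ->
  disconnected (fun c => tensor_step (k t) f (exchange tau0 c)).
Proof.
case=> fs fp f1; split.
- move=> i c d; have A0 x : comp (tau0 x).1 == i = (comp x.1 == i) by rewrite comp_tau0.
  by rewrite !(@exchange_mix _ _ _ _ tau0 (fun v => comp v == i)) // tensor_step_splits.
- by move=> c; rewrite (exchange_relabel _ tau0_p) (tensor_step_relabel _ pK p'K).
- by rewrite mass_exchange // mass_tensor_step.
Qed.

Lemma disconnected_silence f : disconnected f -> disconnected (silence f).
Proof.
case=> fs fp f1; split.
- move=> i c d; rewrite /silence; have := messages_mix (fun v => comp v == i) c d.
  by do 4?[case: (messages _ == 0%N) => //=]; rewrite ?mul0r ?mulr0 // => _; exact: fs.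
- by move=> c; rewrite /silence messages_relabel ?fp //; exists p'.
- apply: le_trans f1; apply: ler_sum => c _; rewrite /silence.
  by case: ifP => // _; rewrite sqmod0 sqmod_ge0.
Qed.

Lemma disconnected_close t : exists f, disconnected f /\
  mass (fun c => f c - chi t c) <= 18 / K%:R * \sum_(s < t) mean_messages s.
Proof.
elim: t => [|t [f [fd fclose]]].
  (* All networks start in the same product state, so the initial distance is 0. *)
  exists (port_run tau0 0); split; last first.
    rewrite big_ord0 mulr0 /mass big1 // => c _; apply/eqP.
    rewrite sqmod_eq0 subr_eq0 /average /= sumr_const -[X in _ * X]mulr_natl mulKf //.
    by rewrite pnatr_eq0 -lt0n.
  split.
  - move=> i c d /=; rewrite -!big_split /=; apply: eq_bigr => v _.
    by rewrite !mixE; case: (comp v == i) => //; rewrite mulrC.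
  - move=> c /=; rewrite [RHS](reindex p) /=; last by apply: onW_bij; exists p'.
    by apply: eq_bigr => v _; rewrite relabelE.
  - by rewrite mass_port_run.
set Z := fun c => tensor_step (k t) (chi t) (exchange tau0 c).
set w := average (crossing t).
set Y := fun c => tensor_step (k t) f (exchange tau0 c).
have Yd : disconnected Y by exact: disconnected_step.
have YZ : mass (fun c => Y c - Z c) = mass (fun c => f c - chi t c).
  rewrite -[RHS](mass_tensor_step _ (k_unitary t)) -[RHS](mass_exchange _ tau0K).
  apply: eq_bigr => c _; congr sqmod; rewrite -[LHS]/(tensor_step (k t) f (exchange tau0 c)
    - tensor_step (k t) (chi t) (exchange tau0 c)) -mulN1r -tensor_step_lin.
  by apply: eq_bigr => d _; rewrite mulN1r.
have silent_w c : messages c = 0%N -> w c = 0.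
  move=> c0; rewrite /w /average big1 ?mulr0 // => e _; apply/eqP.
  apply: contraTT isT => /crossing_neq0[/existsP[x /andP[_ cx]] _].
  move: (card_occupied c); rewrite c0 leqn0 cards_eq0 => /eqP/setP/(_ x).
  by rewrite !inE cx.
have loud := loud_mass t; rewrite -/Z in loud.
have cross := mass_average_crossing t; rewrite -/w in cross.
set s := \sum_(c | messages c != 0%N) sqmod (Z c) in loud.
set y := \sum_(c | messages c != 0%N) sqmod (Y c - Z c).
have K1 : K%:R^-1 <= 1 :> R by rewrite invf_le1 // ler1n.
have Ki0 : 0 < K%:R^-1 :> R by rewrite invr_gt0.
have K1' : 1 <= K%:R :> R by rewrite ler1n.
have mw0 : 0 <= mass w by apply: sumr_ge0 => *; exact: sqmod_ge0.
have step : 18 / K%:R * \sum_(s < t.+1) mean_messages s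
    = 18 / K%:R * \sum_(s < t) mean_messages s + 18 * mean_messages t / K%:R.
  by rewrite big_ord_recr /=; ring.
(* In the small case the extra cost is [y / K + (1 + K) * mass w], at most
   [2 * s / K + 4 * K * mass w]; the two terms are at most 2 and 16 times [mean_messages t / K],
   whence 18. *)
have [y_small|y_large] := leP y (2 * s + 2 * mass w).
  exists Y; split=> //; rewrite step.
  have pw c : sqmod (Y c - chi t.+1 c) <= sqmod (Y c - Z c)
     + (if messages c != 0%N then K%:R^-1 * sqmod (Y c - Z c) else 0)
     + (1 + K%:R) * sqmod (w c).
    rewrite chiS -/(Z c) -/(w c) opprD addrA; case: eqP => [/silent_w ->|_] /=.
      by rewrite subr0 sqmod0; lra.
    by have := sqmodD_le (Y c - Z c) (- w c) k_gt0; rewrite sqmodN; lra.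
  apply: le_trans (_ : _ <= \sum_c (sqmod (Y c - Z c)
     + (if messages c != 0%N then K%:R^-1 * sqmod (Y c - Z c) else 0)
     + (1 + K%:R) * sqmod (w c))) _; first by apply: ler_sum => c _; exact: pw.
  rewrite big_split big_split -big_mkcond /= -mulr_sumr -mulr_sumr -/y -/(mass w).
  rewrite (_ : \sum_c sqmod (Y c - Z c) = mass (fun c => f c - chi t c)); last exact: YZ.
  have l1 : K%:R^-1 * y <= 2 * (K%:R^-1 * s) + 2 * (1 * mass w).
    apply: (@le_trans _ _ (K%:R^-1 * (2 * s + 2 * mass w))); first by rewrite ler_pM2l.
    have : K%:R^-1 * mass w <= 1 * mass w by rewrite ler_wpM2r.
    by lra.
  have l2 : K%:R^-1 * s <= mean_messages t / K%:R by rewrite mulrC ler_wpM2r // ltW.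
  have l3 : K%:R * mass w <= 4 * mean_messages t / K%:R.
    by apply: le_trans (K_mean t); rewrite ler_pM2l.
  have l4 : 1 * mass w <= K%:R * mass w by rewrite ler_wpM2r.
  have -> : 18 * mean_messages t / K%:R = 18 * (mean_messages t / K%:R) by rewrite mulrA.
  have : 4 * mean_messages t / K%:R = 4 * (mean_messages t / K%:R) by rewrite mulrA.
  by move: fclose l1 l2 l3 l4; lra.
(* After the projection, the error on non-silent configurations is the mass of the new average
   there, at most [2 * s + 2 * mass w], hence less than [y]: the distance does not grow. *)
exists (silence Y); split; first exact: disconnected_silence.
rewrite step; apply: (@le_trans _ _ (mass (fun c => f c - chi t c))); last first.
  apply: ler_wpDr => //; apply: divr_ge0; last exact: ltW.
  by have := mean_messages_ge0 t; lra.
rewrite -YZ /mass (bigID (fun c => messages c != 0%N)) /=.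
rewrite [leRHS](bigID (fun c => messages c != 0%N)) /= -/y.
apply: lerD; last first.
  apply: ler_sum => c; rewrite negbK => c0; rewrite /silence c0 chiS -/(Z c) -/(w c).
  by rewrite (silent_w c (eqP c0)) addr0.
apply: le_trans (ltW y_large).
apply: (@le_trans _ _ (\sum_(c | messages c != 0%N) (2 * sqmod (Z c) + 2 * sqmod (w c)))).
  apply: ler_sum => c c0; rewrite /silence (negPf c0) sub0r sqmodN chiS.
  exact: sqmodD_le2.
rewrite big_split /= -!mulr_sumr -/s lerD2l ler_pM2l // /mass [leLHS]big_mkcond.
by apply: ler_sum => c _; case: ifP => // _; exact: sqmod_ge0.
Qed.

Lemma mass_chi t : 1 - 5 / K%:R * \sum_(s < t) mean_messages s <= mass (chi t).
Proof.
elim: t => [|t IH].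
  rewrite big_ord0 mulr0 subr0 le_eqVlt; apply/orP; left; apply/eqP.
  rewrite -(mass_port_run 0 tau0K); apply: eq_bigr => c _; congr sqmod.
  rewrite /average /= sumr_const -[X in _ * X]mulr_natl mulKf //.
  by rewrite pnatr_eq0 -lt0n.
apply: le_trans (mass_chiS t); rewrite big_ord_recr /=.
have -> : 5 * mean_messages t / K%:R = 5 / K%:R * mean_messages t by ring.
by move: IH; lra.
Qed.

Lemma leader_election_messages T :
  (forall e, 1 - \sum_(c : cfg | unique_leader status_of c)
     sqmod (port_run (tau e) T c) <= 3%:R^-1) ->
  exists e, (K <= 1572 * \sum_(t < T) port_messages (tau e) t)%N.
Proof.
move=> success.
have [f [[fs fp f1] fclose]] := disconnected_close T.
have fgood : \sum_(c : cfg | unique_leader status_of c) sqmod (f c) <= 2^-1.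
  apply: le_trans (twin_unique_leader_mass status_of pK p'K comp_p fs fp) _.
  by move: f1; lra.
set L := fun c : cfg => unique_leader status_of c in success fgood.
(* By convexity the average fails with no more mass than the networks do in the mean. *)
have bad : \sum_(c | ~~ L c) sqmod (chi T c) <= 3%:R^-1.
  apply: le_trans (sum_average_le _ _) _.
  rewrite ler_pdivrMl //; apply: (@le_trans _ _ (\sum_(e : E) 3%:R^-1)); last first.
    by rewrite sumr_const -[leLHS]mulr_natl.
  apply: ler_sum => e _; apply: le_trans (success e).
  rewrite -(mass_port_run T (tauK e)) /mass [in leRHS](bigID L) /=.
  by rewrite addrAC subrr add0r.
(* Weight 6 gives [(1 + 1 / 6) / 2 = 7 / 12], which added to the failure bound [1 / 3] stays
   [1 / 12] below 1. *)
have good : \sum_(c | L c) sqmod (chi T c) <= 7 / 12 + 7 * mass (fun c => f c - chi T c).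
  apply: (@le_trans _ _ (\sum_(c | L c) ((1 + 6^-1) * sqmod (f c)
      + (1 + 6) * sqmod (f c - chi T c)))).
    apply: ler_sum => c _; rewrite -(sqmodN (f c - chi T c)) opprB.
    have := @sqmodD_le R 6 (f c) (chi T c - f c); rewrite addrC subrK; exact.
  rewrite big_split /= -!mulr_sumr.
  have : \sum_(c | L c) sqmod (f c - chi T c) <= mass (fun c => f c - chi T c).
    rewrite /mass big_mkcond; apply: ler_sum => c _.
    by case: ifP => // _; exact: sqmod_ge0.
  by move: fgood; lra.
have total := mass_chi T.
rewrite {1}/mass (bigID L) /= in total.
set A := \sum_(s < T) mean_messages s in fclose total.
(* The gap [1 / 12] must be covered by [(5 + 7 * 18) * A / K = 131 * A / K], and
   [12 * 131 = 1572]. *)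
have KA : K%:R <= 1572 * A.
  have : 12^-1 <= 131 * (A / K%:R).
    have e1 : 5 / K%:R * A = 5 * (A / K%:R) by ring.
    have e2 : 18 / K%:R * A = 18 * (A / K%:R) by ring.
    by rewrite e1 e2 in fclose total; move: bad good; lra.
  rewrite mulrA ler_pdivlMr //; lra.
pose m e := (\sum_(t < T) port_messages (tau e) t)%N.
have /card_gt0P[e0 _] := E_gt0.
(* The maximum over the networks is at least the mean [A]. *)
pose e := [arg max_(e > e0) m e]; exists e.
rewrite -(ler_nat R) natrM; apply: le_trans KA _; rewrite ler_pM2l //.
rewrite /A /mean_messages -mulr_sumr exchange_big /= ler_pdivrMl // mulr_natl.
rewrite -sumr_const; apply: ler_sum => e' _; rewrite -natr_sum ler_nat.
by rewrite /e; case: arg_maxnP => // e1 _; exact.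
Qed.

End HiddenEdge.

(** * Regular networks *)

Section CastNode.
Variables (R : realType) (P : protocol R).

Definition node_at (d : nat) : finType := local_basis (qubits P) (memory P d) d.

(** The degree of a node equals the common degree only propositionally, so local bases are
    transported along that equality. *)
Definition cast_node d d' (e : d = d') (s : node_at d) : node_at d' :=
  ecast x (node_at x) e s.

Definition initial_amplitude d (s : node_at d) : R[i] :=
  if [&& status_of s == Undecided, emission s == empty_registers P d
       & reception s == empty_registers P d]
  then init_memory (memory_of s) else 0.

Definition kernel d t (s s' : node_at d) : R[i] :=
  unitary P t d (enum_rank s) (enum_rank s').

Variables (d d' : nat) (e : d = d').
Implicit Type s : node_at d.

Lemma cast_nodeK : cancel (cast_node e) (cast_node (esym e)).
Proof. by case: d' / e. Qed.

Lemma cast_nodeKV : cancel (cast_node (esym e)) (cast_node e).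
Proof. by case: d' / e. Qed.

Lemma status_cast s : status_of (cast_node e s) = status_of s.
Proof. by case: d' / e. Qed.

Lemma emission_cast s i : emission (cast_node e s) i = emission s (cast_ord (esym e) i).
Proof. by case: d' / e i => i; rewrite cast_ord_id. Qed.

Lemma reception_cast s i :
  reception (cast_node e s) i = reception s (cast_ord (esym e) i).
Proof. by case: d' / e i => i; rewrite cast_ord_id. Qed.

Lemma cast_node_ext s (s' : node_at d') : status_of s = status_of s' ->
  memory_of (cast_node e s) = memory_of s' ->
  (forall i, emission s (cast_ord (esym e) i) = emission s' i) ->
  (forall i, reception s (cast_ord (esym e) i) = reception s' i) ->
  cast_node e s = s'.
Proof.
by move=> *; apply: node_ext => [||i|i] //;
  rewrite ?status_cast ?emission_cast ?reception_cast.
Qed.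

Lemma memory_cast s s' : memory_of s = memory_of s' ->
  memory_of (cast_node e s) = memory_of (cast_node e s').
Proof. by case: d' / e. Qed.

Lemma kernel_cast t s s' : kernel t (cast_node e s) (cast_node e s') = kernel t s s'.
Proof. by case: d' / e. Qed.

Lemma initial_amplitude_cast s :
  initial_amplitude (cast_node e s) = initial_amplitude s.
Proof. by case: d' / e. Qed.

Lemma card_emission_cast s :
  #|[set i | emission (cast_node e s) i != None]| = #|[set i | emission s i != None]|.
Proof. by case: d' / e. Qed.

Lemma card_reception_cast s :
  #|[set i | reception (cast_node e s) i != None]| = #|[set i | reception s i != None]|.
Proof. by case: d' / e. Qed.

End CastNode.

Lemma initial_amplitude_unit (R : realType) (P : protocol R) d :
  \sum_(s : node_at P d) sqmod (initial_amplitude s) = 1.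
Proof.
rewrite -(init_memory_unit P d).
pose h (x : memory P d) : node_at P d :=
  (((Undecided, x), empty_registers P d), empty_registers P d).
rewrite (bigID (fun s : node_at P d => [&& status_of s == Undecided,
   emission s == empty_registers P d & reception s == empty_registers P d])) /=.
rewrite [X in _ + X]big1 ?addr0; last first.
  by move=> s sN; rewrite /initial_amplitude (negPf sN) sqmod0.
rewrite (reindex_onto h (@memory_of _ _ _)) /=; last first.
  move=> s /and3P[/eqP s1 /eqP s2 /eqP s3].
  by apply: node_ext => // i; rewrite ?s2 ?s3.
by apply: eq_big => [x|x _]; rewrite /initial_amplitude ?eqxx.
Qed.

Section RegularNetwork.
Variables (R : realType) (P : protocol R) (n : nat) (G : network n) (D : nat).
Hypothesis degE : forall u, deg G u = D.
Variable tau : 'I_n * 'I_D -> 'I_n * 'I_D.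
Hypothesis tauK : involutive tau.
Hypothesis portE : forall u (i : 'I_(deg G u)),
  port i = (tau (u, cast_ord (degE u) i)).1.
Local Notation node := (node_at P D).
Implicit Type c : config P G.

Definition flat c : {ffun 'I_n -> node} := [ffun u => cast_node (degE u) (c u)].

Lemma flat_bij : bijective flat.
Proof.
exists (fun c : {ffun 'I_n -> node} =>
  [ffun u => cast_node (esym (degE u)) (c u)] : config P G).
- by move=> c; apply/ffunP => u; rewrite !ffunE cast_nodeK.
- by move=> c; apply/ffunP => u; rewrite !ffunE cast_nodeKV.
Qed.

Lemma port_to_tau u i : port_to G (tau (u, i)).1 u
   = Some (cast_ord (esym (degE _)) (tau (u, i)).2).
Proof.
rewrite /port_to; set v := (tau (u, i)).1; set j := cast_ord _ _.
have pj : port j = u.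
  by rewrite portE /j cast_ordKV -surjective_pairing tauK.
case: pickP => [j' /eqP pj'|/(_ j)]; last by rewrite pj eqxx.
by congr Some; apply: (@port_inj _ G); rewrite pj.
Qed.

Lemma flat_send c : flat (send_config c) = exchange tau (flat c).
Proof.
apply/ffunP => u; rewrite [LHS]ffunE.
have pE i : port (cast_ord (esym (degE u)) i) = (tau (u, i)).1.
  by rewrite portE cast_ordKV.
apply: cast_node_ext => [||i|i].
- by rewrite status_exchange !ffunE status_cast.
- by rewrite memory_exchange [flat c u]ffunE; apply: memory_cast; rewrite ffunE.
- rewrite emission_exchange [flat c _]ffunE reception_cast.
  by rewrite [send_config c u]ffunE /emission /= ffunE pE /received port_to_tau.
- rewrite reception_exchange [flat c _]ffunE emission_cast.
  by rewrite [send_config c u]ffunE /reception /= ffunE pE /emitted port_to_tau.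
Qed.

(** [send] sums over preimages; as [send_config] is an involution, there is exactly one. *)
Lemma send_flat (psi : state P G) f :
  (forall c, psi c = f (flat c)) ->
  forall c, send psi c = f (exchange tau (flat c)).
Proof.
move=> psiE c; rewrite ffunE.
have sK : involutive (@send_config R n P G).
  move=> c'; apply: (bij_inj flat_bij).
  by rewrite !flat_send exchangeK.
rewrite (big_pred1 (send_config c)) ?psiE ?flat_send // => c' /=.
by rewrite (can2_eq sK sK).
Qed.

Lemma local_step_flat t (psi : state P G) f :
  (forall c, psi c = f (flat c)) ->
  forall c, local_step t psi c = tensor_step (kernel t) f (flat c).
Proof.
move=> psiE c; rewrite ffunE /tensor_step [RHS](reindex flat) /=; last first.
  by apply: onW_bij; exact: flat_bij.
apply: eq_bigr => c' _; rewrite psiE; congr (_ * _).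
by apply: eq_bigr => u _; rewrite !ffunE kernel_cast.
Qed.

Local Notation prun := (port_run (@kernel R P D) (@initial_amplitude R P D) tau).

Lemma run_flat t c : run P G t c = prun t (flat c).
Proof.
elim: t c => [|t IH] c /=.
  by rewrite ffunE; apply: eq_bigr => u _; rewrite ffunE initial_amplitude_cast.
by rewrite (send_flat (local_step_flat t IH)).
Qed.

Lemma config_messages_flat c : config_messages c = messages (flat c).
Proof.
by apply: eq_bigr => u _; rewrite ffunE card_emission_cast card_reception_cast.
Qed.

Lemma round_messages_flat t : round_messages P G t =
  port_messages (@kernel R P D) (@initial_amplitude R P D) tau t.
Proof.
rewrite /port_messages (reindex flat) /=; last by apply: onW_bij; exact: flat_bij.
apply: eq_big => [c|c _]; last exact: config_messages_flat.
by rewrite (local_step_flat t (run_flat t)).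
Qed.

Lemma success_probability_flat t : success_probability P G t =
  \sum_(c : {ffun 'I_n -> node} | unique_leader status_of c) sqmod (prun t c).
Proof.
rewrite /success_probability [RHS](reindex flat) /=; last first.
  by apply: onW_bij; exact: flat_bij.
apply: eq_big => [c|c _]; last by rewrite run_flat.
apply: eq_existsb => u; rewrite ffunE status_cast; congr (_ && _).
by apply: eq_forallb => v; rewrite ffunE status_cast.
Qed.

End RegularNetwork.

(** * The network defined by a fixed-point-free pairing of ports *)

Section NetworkOfPorts.
Variables (n D : nat) (tau : 'I_n * 'I_D -> 'I_n * 'I_D).
Hypothesis tauK : involutive tau.
Hypothesis tau_irr : forall u i, (tau (u, i)).1 != u.
Hypothesis tau_inj : forall u, injective (fun i => (tau (u, i)).1).

Definition port_adj_rel : rel 'I_n := fun u v => [exists i, (tau (u, i)).1 == v].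

Lemma port_adj_sym : symmetric port_adj_rel.
Proof.
suff H u v : port_adj_rel u v -> port_adj_rel v u.
  by move=> u v; apply/idP/idP; exact: H.
case/existsP => i /eqP uv; apply/existsP; exists (tau (u, i)).2.
by rewrite -uv -surjective_pairing tauK.
Qed.

Lemma port_adj_irr : irreflexive port_adj_rel.
Proof.
by move=> u; apply/negbTE/existsPn => i; exact: tau_irr.
Qed.

Lemma port_adj_card u : #|[pred v | port_adj_rel u v]| = D.
Proof.
rewrite -[RHS]card_ord -(card_codom (@tau_inj u)); apply: eq_card => v.
rewrite inE; apply/existsP/codomP => [[i /eqP <-]|[i ->]]; first by exists i.
by exists i.
Qed.

Lemma port_adj_tau u i : port_adj_rel u (tau (u, i)).1.
Proof. by apply/existsP; exists i. Qed.

Definition network_of_ports : network n :=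
  @Network n port_adj_rel port_adj_sym port_adj_irr
    (fun u i => (tau (u, cast_ord (port_adj_card u) i)).1)
    (fun u i j ij => cast_ord_inj (tau_inj ij))
    (fun u i => port_adj_tau u _).

End NetworkOfPorts.

(** * Rings with a hidden chord *)

(** [b] is a lower bound on the ring lengths, which may differ. [next] orders the rings cyclically;
    the three inequations on its iterates serve the diameter. [twin] is a rotation-equivariant
    bijection taking each ring to another one. *)
Record ring_system (V I : finType) (b : nat) := RingSystem {
  step : V -> V;
  back : V -> V;
  ring_of : V -> I;
  root_of : I -> V;
  next : I -> I;
  prev : I -> I;
  twin : V -> V;
  twin_inv : V -> V;
  stepK : cancel step back;
  backK : cancel back step;
  ring_step : forall v, ring_of (step v) = ring_of v;
  ring_root : forall i, ring_of (root_of i) = i;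
  step_free : forall v k l, (k < b)%N -> (l < b)%N ->
    iter k step v = iter l step v -> k = l;
  step_reach : forall u v, ring_of u = ring_of v -> exists k, iter k step u = v;
  nextK : cancel next prev;
  prevK : cancel prev next;
  next_neq : forall i, next i != i;
  next2_neq : forall i, next (next i) != i;
  next3_neq : forall i, next (next (next i)) != i;
  next_reach : forall i j, exists k, iter k next i = j;
  twinK : cancel twin twin_inv;
  twin_invK : cancel twin_inv twin;
  twin_step : forall v, step (twin v) = twin (step v);
  twin_ring : forall u v, ring_of u = ring_of v -> ring_of u != ring_of (twin v)
}.

Section RingPorts.
Variables (V I : finType) (b g : nat) (S : ring_system V I b).
Local Notation h := g.+1.
Hypothesis hb : (h + h < b)%N.
Local Notation port := (V * 'I_(h + h))%type.
Local Notation edge := ('I_b * 'I_g)%type.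
Implicit Types (u v : V) (p : port) (e : edge).

Definition fwd k v := iter k (step S) v.
Definition bwd k v := iter k (back S) v.
Definition foot i (x : 'I_b) : V := fwd x (root_of S i).

(* Port [l < h] leads [l.+1] steps forward and port [h + l] leads [l.+1] steps
   backward. *)
Definition ring_port p : port :=
  match split p.2 with
  | inl l => (fwd l.+1 p.1, rshift h l)
  | inr l => (bwd l.+1 p.1, lshift h l)
  end.

(* The edge [(x, l)] names, in each ring, the chord of length [l.+2] starting at
   offset [x]; length 1 is excluded so that the rings stay connected when the
   chord is cut. *)
Definition on_edge e p : bool :=
  match split p.2 with
  | inl l => (l == lift ord0 e.2) && (p.1 == foot (ring_of S p.1) e.1)
  | inr l => (l == lift ord0 e.2) && (bwd l.+1 p.1 == foot (ring_of S p.1) e.1)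
  end.

(** The chord leaving ring [i] now ends where the chord of ring [next i] ended. Port numbers at both
    ends are unchanged, so no node sees the difference locally. *)
Definition crossed_port e p : port :=
  if on_edge e p then
    match split p.2 with
    | inl l => (fwd l.+1 (foot (next S (ring_of S p.1)) e.1), rshift h l)
    | inr l => (foot (prev S (ring_of S p.1)) e.1, lshift h l)
    end
  else ring_port p.

Lemma fwdK k : cancel (fwd k) (bwd k).
Proof.
by elim: k => [//|k IH] v; rewrite /bwd iterSr /fwd iterS stepK; exact: IH.
Qed.

Lemma bwdK k : cancel (bwd k) (fwd k).
Proof.
by elim: k => [//|k IH] v; rewrite /fwd iterSr /bwd iterS backK; exact: IH.
Qed.

Lemma ring_back v : ring_of S (back S v) = ring_of S v.
Proof. by rewrite -{2}[v](backK S) ring_step. Qed.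

Lemma ring_fwd k v : ring_of S (fwd k v) = ring_of S v.
Proof. by elim: k => //= k IH; rewrite ring_step. Qed.

Lemma ring_bwd k v : ring_of S (bwd k v) = ring_of S v.
Proof. by elim: k => //= k IH; rewrite ring_back. Qed.

Lemma fwd_twin k v : fwd k (twin S v) = twin S (fwd k v).
Proof. by elim: k => //= k ->; rewrite twin_step. Qed.

Lemma bwd_twin k v : bwd k (twin S v) = twin S (bwd k v).
Proof. by rewrite -[v in LHS](bwdK k) -fwd_twin fwdK. Qed.

#[local] Arguments fwd : simpl never.
#[local] Arguments bwd : simpl never.

Lemma ring_foot i x : ring_of S (foot i x) = i.
Proof. by rewrite /foot ring_fwd ring_root. Qed.

Lemma split_l m n (l : 'I_m) : split (lshift n l) = inl l.
Proof. exact: (unsplitK (inl l)). Qed.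

Lemma split_r m n (l : 'I_n) : split (rshift m l) = inr l.
Proof. exact: (unsplitK (inr l)). Qed.

Variant port_spec : port -> Type :=
  | PortFwd v l : port_spec (v, lshift h l)
  | PortBwd v l : port_spec (v, rshift h l).

Lemma portP p : port_spec p.
Proof.
by case: p => v j; rewrite -(splitK j); case: (split j) => l; constructor.
Qed.

Definition portsE := (split_l, split_r).

Lemma ring_portK : involutive ring_port.
Proof.
by move=> p; case: (portP p) => v l; rewrite /ring_port /= ?portsE /= ?portsE /= ?fwdK ?bwdK.
Qed.

Lemma on_edge_ring e p : on_edge e p -> on_edge e (ring_port p).
Proof.
by case: (portP p) => v l; rewrite /on_edge /ring_port /= ?portsE /= ?portsE /=
  ?fwdK ?ring_fwd ?ring_bwd.
Qed.

Lemma on_edge_crossed e p : on_edge e p -> on_edge e (crossed_port e p).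
Proof.
move=> ep; rewrite /crossed_port ep; move: ep.
case: (portP p) => v l; rewrite /on_edge /= ?portsE /= ?portsE => /andP[-> _] /=.
  by rewrite fwdK ring_fwd ring_foot.
by rewrite ring_foot.
Qed.

Lemma crossed_port_off e p : ~~ on_edge e p -> crossed_port e p = ring_port p.
Proof. by rewrite /crossed_port => /negPf ->. Qed.

Lemma crossed_portK e : involutive (crossed_port e).
Proof.
move=> p; have [ep|ep] := boolP (on_edge e p); last first.
  have : ~~ on_edge e (ring_port p).
    by apply: contra ep => /on_edge_ring; rewrite ring_portK.
  by move=> ?; rewrite !crossed_port_off // ring_portK.
rewrite {1}/crossed_port on_edge_crossed // /crossed_port ep; move: ep.
case: (portP p) => v l; rewrite /on_edge /= ?portsE /= ?portsE => /andP[_ /eqP E].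
  by rewrite ring_fwd ring_foot nextK -E.
by rewrite ring_foot prevK -E bwdK.
Qed.

Lemma on_edge_inj e e' p : on_edge e p -> on_edge e' p -> e = e'.
Proof.
case: e e' => [x k] [x' k']; case: (portP p) => v l; rewrite /on_edge /= ?portsE;
  move=> /andP[/eqP lk /eqP E] /andP[/eqP lk' /eqP E'];
  (have -> : k = k' by apply: (@lift_inj _ ord0); rewrite -lk -lk');
  congr (_, _); apply: val_inj; apply: (step_free (r := S)) (ltn_ord _) (ltn_ord _) _;
  exact: etrans (esym E) E'.
Qed.

Lemma ring_ring_port p : ring_of S (ring_port p).1 = ring_of S p.1.
Proof.
by case: (portP p) => v l; rewrite /ring_port /= ?portsE /= ?ring_fwd ?ring_bwd.
Qed.

Lemma ring_port_twin v j :
  ring_port (twin S v, j) = (twin S (ring_port (v, j)).1, (ring_port (v, j)).2).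
Proof.
by rewrite /ring_port /=; case: (split j) => l; rewrite ?fwd_twin ?bwd_twin.
Qed.

Lemma ring_crossed_port e p : on_edge e p ->
  ring_of S (crossed_port e p).1 = next S (ring_of S p.1) \/
  ring_of S p.1 = next S (ring_of S (crossed_port e p).1).
Proof.
rewrite /crossed_port => ->; case: (portP p) => v l; rewrite /= ?portsE /=.
  by left; rewrite ring_fwd ring_foot.
by right; rewrite ring_foot prevK.
Qed.

Lemma on_edgeE e p :
  on_edge e p = (ring_of S (crossed_port e p).1 != ring_of S p.1).
Proof.
have [ep|ep] := boolP (on_edge e p); last first.
  by rewrite crossed_port_off // ring_ring_port eqxx.
by have [->|->] := ring_crossed_port ep; rewrite ?next_neq // eq_sym next_neq.
Qed.

(** The displacement along port [j], shifted by [h] to be nonnegative, so that [step_free] can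
    compare neighbours; the node itself has offset [h]. *)
Definition offset (j : 'I_(h + h)) : nat :=
  match split j with inl l => h + l.+1 | inr l => h - l.+1 end.

Lemma fwd_ring_port v j : fwd h (ring_port (v, j)).1 = fwd (offset j) v.
Proof.
rewrite /ring_port /offset /=; case: (split j) => l.
  by rewrite /= /fwd -iterD.
have lh : (l < h)%N by [].
by rewrite -{1}(subnK lh) /fwd iterD -[iter l.+1 _ _]/(fwd l.+1 _) bwdK.
Qed.

Lemma offset_lt j : (offset j < b)%N.
Proof.
apply: leq_ltn_trans hb; rewrite /offset.
by case: (split j) => l; have := ltn_ord l; lia.
Qed.

Lemma offset_neq j : offset j != h.
Proof. by rewrite /offset; case: (split j) => l; have := ltn_ord l; lia. Qed.

Lemma offset_inj : injective offset.
Proof.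
move=> j j'; rewrite /offset.
case: (split_ordP j) => l ->; case: (split_ordP j') => l' -> H;
  have := ltn_ord l; have := ltn_ord l' => lt lt'.
- by congr lshift; apply: val_inj => /=; lia.
- by exfalso; lia.
- by exfalso; lia.
- by congr rshift; apply: val_inj => /=; lia.
Qed.

Lemma crossed_port_irr e v j : (crossed_port e (v, j)).1 != v.
Proof.
have [ej|ej] := boolP (on_edge e (v, j)).
  by move: ej; rewrite on_edgeE; apply: contraNneq => ->.
rewrite crossed_port_off //; apply/eqP => /(congr1 (fwd h)).
rewrite fwd_ring_port => /(step_free (r := S) (offset_lt j)) H.
by have := offset_neq j; rewrite H ?eqxx //; apply: leq_trans hb; rewrite ltnS leq_addr.
Qed.

(** The ring of the common neighbour tells whether the ports are on the edge. Off it, offsets are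
    injective; on it, a forward and a backward port at [v] would make the chord a loop. *)
Lemma crossed_port_inj e v : injective (fun j => (crossed_port e (v, j)).1).
Proof.
move=> j j' /= E.
have : on_edge e (v, j) = on_edge e (v, j') by rewrite !on_edgeE E.
have [ej ej'|ej ej'] := boolP (on_edge e (v, j)); last first.
  move: E; rewrite !crossed_port_off -?ej' // => /(congr1 (fwd h)).
  by rewrite !fwd_ring_port => /(step_free (r := S) (offset_lt j) (offset_lt j'))/offset_inj.
have lb (l : 'I_h) : (l.+1 < b)%N.
  by apply: leq_trans hb; rewrite ltnS (leq_trans (ltn_ord l)) // leq_addr.
have b0 : (0 < b)%N by apply: leq_trans hb.
have loop (l : 'I_h) u : bwd l.+1 u != u.
  apply/eqP => /(congr1 (fwd l.+1)); rewrite bwdK => H.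
  by have := step_free (r := S) (lb l) b0 (esym H).
move: ej (esym ej'); rewrite /on_edge /=.
case: (split_ordP j) => l ->; case: (split_ordP j') => l' ->;
  move=> /andP[/eqP -> /eqP H] /andP[/eqP -> /eqP H'] //.
  by have := loop (lift ord0 e.2) v; rewrite H' -H eqxx.
by have := loop (lift ord0 e.2) v; rewrite H -H' eqxx.
Qed.

Lemma crossed_port0 e v : crossed_port e (v, lshift h ord0) = (step S v, rshift h ord0).
Proof.
by rewrite crossed_port_off ?/ring_port /= ?portsE // /on_edge ?portsE.
Qed.

Lemma crossed_port_foot e i :
  crossed_port e (foot i e.1, lshift h (lift ord0 e.2))
    = (fwd (lift ord0 e.2).+1 (foot (next S i) e.1), rshift h (lift ord0 e.2)).
Proof.
by rewrite /crossed_port /on_edge /= ?portsE ring_foot !eqxx.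
Qed.

(** Chords of an edge have length at least 2, so the node just after the foot is not an end of the
    chord. *)
Lemma on_edge_step_foot e i j : ~~ on_edge e (step S (foot i e.1), j).
Proof.
have b1 : (1 < b)%N by apply: leq_trans hb; rewrite addnS.
have lb (l : 'I_h) : (l.+1 < b)%N.
  by apply: leq_trans hb; rewrite ltnS (leq_trans (ltn_ord l)) // leq_addr.
rewrite /on_edge /= ring_step ring_foot.
case: (split j) => l; apply/negP => /andP[/eqP lE /eqP H].
  by have := step_free (r := S) (v := foot i e.1) b1 (ltnW b1) H.
have {H} : fwd 1 (foot i e.1) = fwd l.+1 (foot i e.1) by rewrite -{2}H bwdK.
by move=> /(step_free (r := S) b1 (lb _)); rewrite lE.
Qed.

End RingPorts.

Section RingNetwork.
Variables (n b g : nat) (I : finType) (S : ring_system 'I_n I b).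
Hypothesis hb : (g.+1 + g.+1 < b)%N.
Local Notation edge := ('I_b * 'I_g)%type.
Implicit Type e : edge.

Definition ring_network e : network n :=
  network_of_ports (crossed_portK S e) (crossed_port_irr S hb e)
    (@crossed_port_inj _ _ _ _ S hb e).

Lemma adj_crossed e u j : adj (ring_network e) u (crossed_port S e (u, j)).1.
Proof. exact: port_adj_tau. Qed.

(** Edges of length 1 are never cut and keep each ring connected; the crossed chords link each ring
    to the next. *)
Lemma ring_network_connected e : connected (ring_network e).
Proof.
have sym : connect_sym (adj (ring_network e)).
  by apply: sym_connect_sym; exact: adj_sym.
have in_ring u v : ring_of S u = ring_of S v -> connect (adj (ring_network e)) u v.
  move=> /(step_reach (r := S))[k <-]; elim: k => [|k IH] /=; first exact: connect0.
  apply: connect_trans IH (connect1 _).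
  by have := adj_crossed e (iter k (step S) u) (lshift _ ord0); rewrite crossed_port0.
have next_ring i :
    connect (adj (ring_network e)) (foot S i e.1) (foot S (next S i) e.1).
  have := adj_crossed e (foot S i e.1) (lshift _ (lift ord0 e.2)).
  rewrite crossed_port_foot => /connect1/connect_trans; apply; apply: in_ring.
  by rewrite ring_fwd.
move=> u v; have [k kv] := next_reach S (ring_of S u) (ring_of S v).
apply: (@connect_trans _ _ (foot S (ring_of S u) e.1)); first by rewrite in_ring ?ring_foot.
apply: (@connect_trans _ _ (foot S (ring_of S v) e.1)); last by rewrite in_ring ?ring_foot.
rewrite -kv; elim: k {kv} => [|k IH] /=; first exact: connect0.
exact: connect_trans IH (next_ring _).
Qed.

Lemma adj_ring_network e u v : adj (ring_network e) u v ->
  [\/ ring_of S v = ring_of S u, ring_of S v = next S (ring_of S u)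
    | ring_of S u = next S (ring_of S v)].
Proof.
case/existsP => j /eqP <-; have [/ring_crossed_port[]|off] := boolP (on_edge S e (u, j)).
- by move=> ->; constructor 2.
- by move=> ->; constructor 3.
- by rewrite crossed_port_off // ring_ring_port; constructor 1.
Qed.

Lemma adj_step_foot e i v : adj (ring_network e) (step S (foot S i e.1)) v ->
  ring_of S v = i.
Proof.
case/existsP => j /eqP <-; rewrite crossed_port_off ?on_edge_step_foot //.
by rewrite ring_ring_port ring_step ring_foot.
Qed.

(** The first edge from [u] stays in ring [i], and every later edge moves by at most one ring, so
    ring [next (next i)] is at least three edges away. *)
Lemma ring_network_diameter e (i : I) : (3 <= n)%N -> (3 <= diameter (ring_network e))%N.
Proof.
move=> n3; set G := ring_network e.
pose u := step S (foot S i e.1); pose v := foot S (next S (next S i)) e.1.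
suff : (3 <= dist G u v)%N.
  move=> /leq_trans; apply; rewrite /diameter.
  apply: leq_trans (leq_bigmax u).
  exact: (leq_bigmax (F := fun v => dist G u v) v).
have ui : ring_of S u = i by rewrite ring_step ring_foot.
have vi : ring_of S v = next S (next S i) by rewrite ring_foot.
have no_walk k : walk G u v k -> (3 <= k)%N.
  case/existsP => -[p /= /eqP <-] /andP[].
  case: p => [|x [|y [|z p]]] //=.
  - by move=> _ /eqP uv; have := next2_neq S i; rewrite -vi -uv ui eqxx.
  - rewrite andbT => /adj_step_foot xi /eqP xv.
    by have := next2_neq S i; rewrite -vi -xv xi eqxx.
  - rewrite andbT => /andP[/adj_step_foot xi /adj_ring_network xy] /eqP yv.
    move: xy; rewrite yv vi xi => -[H|H|H].
    + by have := next2_neq S i; rewrite H eqxx.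
    + by have := next_neq S (next S i); rewrite H eqxx.
    + by have := next3_neq S i; rewrite -H eqxx.
(* The default value [n] of [dist] is itself at least 3. *)
have [lt|ge] := ltnP (dist G u v) n; last exact: leq_trans n3 ge.
apply: no_walk; have : has (walk G u v) (iota 0 n) by rewrite has_find size_iota.
by move=> /(nth_find 0%N); rewrite nth_iota.
Qed.

Lemma ring_network_messages (R : realType) (P : protocol R) T : (0 < g)%N ->
  (forall e, solves_leader_election P (ring_network e) T) ->
  exists e, (g <= 1572 * message_complexity P (ring_network e) T)%N.
Proof.
move=> g0 solves.
have degE e u : deg (ring_network e) u = (g.+1 + g.+1)%N.
  exact: (port_adj_card (@crossed_port_inj _ _ _ _ S hb e)).
have portE e u (j : 'I_(deg (ring_network e) u)) :
  port j = (crossed_port S e (u, cast_ord (degE e u) j)).1.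
  by congr (crossed_port S e (u, _)).1; apply: val_inj.
(* There are [b * g] chords and [g <= b], so [g] can play the role of [K]. *)
have card_edges : (g ^ 2 <= #|{: edge}|)%N.
  by rewrite card_prod !card_ord leq_mul2r; lia.
have ring_success e : 1 - \sum_(c : {ffun 'I_n -> node_at P (g.+1 + g.+1)} |
      unique_leader (@status_of _ _ _) c)
    sqmod (port_run (@kernel R P _) (@initial_amplitude R P _) (crossed_port S e) T c)
      <= 3%:R^-1.
  rewrite -(success_probability_flat P (crossed_portK S e) (portE e)).
  exact: solves e T (leqnn T).
have [e He] := leader_election_messages
  (fun t => unitary_entries (unitary_unitary P t _)) (initial_amplitude_unit P _)
  (@ring_portK _ _ _ _ S) (crossed_portK S) (@crossed_port_off _ _ _ _ S)
  (@on_edge_ring _ _ _ _ S) (@on_edge_crossed _ _ _ _ S) (@on_edge_inj _ _ _ _ S)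
  g0 card_edges (@ring_ring_port _ _ _ _ S) (twinK S) (twin_invK S)
  (@twin_ring _ _ _ S) (@ring_port_twin _ _ _ _ S) ring_success.
exists e; apply: leq_trans He _; rewrite leq_mul2l; apply/orP; right; apply: leq_sum => t _.
by rewrite (round_messages_flat P (crossed_portK S e) (portE e)).
Qed.

End RingNetwork.

Section Transport.
Variables (V W I : finType) (b : nat) (f : V -> W) (f' : W -> V).
Hypotheses (fK : cancel f f') (f'K : cancel f' f).
Variable S : ring_system V I b.

Let iter_conj (s : V -> V) k u : iter k (f \o s \o f') u = f (iter k s (f' u)).
Proof. by elim: k => [|k IH] /=; rewrite ?IH ?fK ?f'K. Qed.

Lemma ring_system_transport : ring_system W I b.
Proof.
apply: (@RingSystem W I b (f \o step S \o f') (f \o back S \o f') (ring_of S \o f')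
  (f \o root_of S) (next S) (prev S) (f \o twin S \o f') (f \o twin_inv S \o f')).
- by move=> u /=; rewrite fK stepK f'K.
- by move=> u /=; rewrite fK backK f'K.
- by move=> u /=; rewrite fK ring_step.
- by move=> i /=; rewrite fK ring_root.
- move=> v k l kb lb; rewrite !iter_conj => /(can_inj fK).
  exact: step_free.
- move=> u v /(step_reach (r := S))[k E]; exists k.
  by rewrite iter_conj E f'K.
- exact: nextK.
- exact: prevK.
- exact: next_neq.
- exact: next2_neq.
- exact: next3_neq.
- exact: next_reach.
- by move=> u /=; rewrite fK twinK f'K.
- by move=> u /=; rewrite fK twin_invK f'K.
- by move=> u /=; rewrite !fK twin_step.
- by move=> u v /= uv; rewrite fK; exact: twin_ring.
Qed.

End Transport.

(** * Two rings of length [a] and three of length [b] *)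

Section FiveRings.
Variables (a b : nat).
Hypotheses (b_gt0 : (0 < b)%N) (ba : (b <= a)%N).
Local Notation nodes := (bool * 'I_a + option bool * 'I_b)%type.
Local Notation rings := (bool + option bool)%type.

Definition on_offsets (s : forall m, 'I_m -> 'I_m) (v : nodes) : nodes :=
  match v with inl (i, x) => inl (i, s a x) | inr (i, x) => inr (i, s b x) end.

Definition five_next (i : rings) : rings :=
  match i with
  | inl false => inl true | inl true => inr None | inr None => inr (Some false)
  | inr (Some false) => inr (Some true) | inr (Some true) => inl false
  end.

Definition five_prev (i : rings) : rings :=
  match i with
  | inl true => inl false | inr None => inl true | inr (Some false) => inr None
  | inr (Some true) => inr (Some false) | inl false => inr (Some true)
  end.

Definition rot3 (i : option bool) : option bool :=
  match i with None => Some false | Some false => Some true | Some true => None end.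

(** The twin map swaps the two long rings and rotates the three others; its inverse is the same with
    the square of the rotation. *)
Definition on_rings (s : option bool -> option bool) (v : nodes) : nodes :=
  match v with inl (i, x) => inl (~~ i, x) | inr (i, x) => inr (s i, x) end.

Definition ring_index (v : nodes) : rings :=
  match v with inl (i, _) => inl i | inr (i, _) => inr i end.

Definition five_root (i : rings) : nodes :=
  match i with
  | inl i => inl (i, Ordinal (leq_trans b_gt0 ba))
  | inr i => inr (i, Ordinal b_gt0)
  end.

Lemma iter_on_offsets k v :
  iter k (on_offsets (@ordS)) v = on_offsets (fun m => iter k (@ordS m)) v.
Proof. by elim: k v => [|k IH] [[i x]|[i x]] //=; rewrite IH. Qed.

Lemma iter_ordS m k (x : 'I_m) : iter k (@ordS m) x = ((x + k) %% m)%N :> nat.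
Proof.
elim: k => [|k IH] /=; first by rewrite addn0 modn_small.
by rewrite IH addnS -addn1 modnDml addn1.
Qed.

Lemma iter_ordS_inj m k l (x : 'I_m) : (k < m)%N -> (l < m)%N ->
  iter k (@ordS m) x = iter l (@ordS m) x -> k = l.
Proof.
move=> km lm /(congr1 val)/eqP; rewrite /= !iter_ordS eqn_modDl !modn_small //.
by move/eqP.
Qed.

Lemma iter_ordS_reach m (x y : 'I_m) : exists k, iter k (@ordS m) x = y.
Proof.
exists (m - x + y)%N; apply: val_inj; rewrite /= iter_ordS addnA subnKC; last exact: ltnW.
by rewrite modnDl modn_small.
Qed.

Lemma five_rings : ring_system nodes rings b.
Proof.
apply: (@RingSystem _ _ _ (on_offsets (@ordS)) (on_offsets (@ord_pred)) ring_index
  five_root five_next five_prev (on_rings rot3) (on_rings (rot3 \o rot3))).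
- by move=> [[i x]|[i x]] /=; rewrite ordSK.
- by move=> [[i x]|[i x]] /=; rewrite ord_predK.
- by move=> [[i x]|[i x]].
- by move=> [i|i].
- move=> [[i x]|[i x]] k l kb lb; rewrite !iter_on_offsets => -[].
  + by apply: iter_ordS_inj; apply: leq_trans ba.
  + exact: iter_ordS_inj.
- move=> [[i x]|[i x]] [[j y]|[j y]] //= [->]; have [k <-] := iter_ordS_reach x y;
    by exists k; rewrite iter_on_offsets.
- by move=> [[]|[[]|]].
- by move=> [[]|[[]|]].
- by move=> [[]|[[]|]].
- by move=> [[]|[[]|]].
- by move=> [[]|[[]|]].
- move=> [[]|[[]|]] [[]|[[]|]];
    by [exists 0%N|exists 1%N|exists 2%N|exists 3%N|exists 4%N].
- by move=> [[[] x]|[[[]|] x]].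
- by move=> [[[] x]|[[[]|] x]].
- by move=> [[[] x]|[[[]|] x]].
- by move=> [[[] x]|[[[]|] x]] [[[] y]|[[[]|] y]].
Qed.

End FiveRings.

(** Equal parities make [n - 3 * b] even, so [a] solves [2 * a + 3 * b = n]; the bound on [5 * b]
    gives [b <= a]. *)
Lemma five_ring_system n b : (0 < b)%N -> (5 * b <= n)%N -> odd n = odd b ->
  ring_system 'I_n (bool + option bool)%type b.
Proof.
move=> b0 bn parity; pose a := ((n - 3 * b) %/ 2)%N.
have na : (2 * a + 3 * b = n)%N by rewrite /a; lia.
have ba : (b <= a)%N by rewrite /a; lia.
have card_nodes : #|{: bool * 'I_a + option bool * 'I_b}| = n.
  by rewrite card_sum !card_prod card_bool card_option card_bool !card_ord.
apply: (@ring_system_transport _ _ _ _ (fun v => cast_ord card_nodes (enum_rank v))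
   (fun i => enum_val (cast_ord (esym card_nodes) i)) _ _ (five_rings b0 ba)).
- by move=> v; rewrite cast_ordK enum_rankK.
- by move=> i; rewrite enum_valK cast_ordKV.
Qed.

Theorem theorem7p7 (R : realType) (A : algorithm R)
  (A_solves : forall (n : nat) (G : network n), connected G ->
     (3 <= diameter G)%N ->
     solves_leader_election (protocol_at A n) G (time A n)) :
  exists (c : R) (n0 : nat), 0 < c /\
    forall n : nat, (n0 <= n)%N ->
      exists G : network n, connected G /\ (3 <= diameter G)%N /\
        c * n%:R <= (message_complexity (protocol_at A n) G (time A n))%:R.
Proof.
exists ((20 * 1572)%N%:R^-1), 100%N; split; first by rewrite invr_gt0 ltr0n.
(* [b] is [n %/ 5] lowered by 1 when its parity is not that of [n], and [g] is nearly the largest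
   value with [2 * (g + 1) < b]. For [n >= 100] this gives [n <= 20 * g], whence the factor 20. *)
move=> n n100; pose b := (n %/ 5 - (n %/ 5 + n) %% 2)%N; pose g := (b %/ 2 - 2)%N.
have b0 : (0 < b)%N by rewrite /b; lia.
have bn : (5 * b <= n)%N by rewrite /b; lia.
have parity : odd n = odd b by rewrite /b; lia.
have hb : (g.+1 + g.+1 < b)%N by rewrite /g /b; lia.
have ng : (n <= 20 * g)%N by rewrite /g /b; lia.
have S := five_ring_system b0 bn parity.
have n3 : (3 <= n)%N by lia.
have conn := ring_network_connected S hb.
have diam e := ring_network_diameter S hb e (inl true) n3.
have g0 : (0 < g)%N by lia.
have [e He] := ring_network_messages g0 (fun e => A_solves _ _ (conn e) (diam e)).
exists (ring_network S hb e); split; first exact: conn.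
split; first exact: diam.
rewrite mulrC ler_pdivrMr ?ltr0n // -natrM ler_nat.
by apply: leq_trans ng _; rewrite [leqRHS]mulnCA leq_mul2l mulnC.
Qed.
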